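(* Let $\Gamma$ be a finite simplicial graph and let $$\mathcal{H}=\{g_1G_{\Lambda_1}g_1^{-1},\ g_2G_{\Lambda_2}g_2^{-1},\ \dots,\ g_nG_{\Lambda_n}g_n^{-1}\}$$ be a collection of parabolic subgroups of the right-angled Coxeter group $G_\Gamma$, where each $\Lambda_i$ is an induced subgraph of $\Gamma$ and $g_i\in G_\Gamma$. Then $\mathcal{H}$ is hyperbolically embedded in $G_\Gamma$ (equivalently, $\mathcal{H}$ is almost malnormal in $G_\Gamma$) if and only if the following two conditions hold: (1) for each $i$, no vertex outside $\Lambda_i$ commutes with two non-adjacent vertices of $\Lambda_i$; and (2) $\Lambda_i\cap\Lambda_j$ is empty or a clique for each $i\ne j$.
   Context: Right-angled Coxeter group: for a finite simplicial graph $\Gamma$ with vertex set $S$, $G_\Gamma$ is the group generated by $S$ with relations $s^2=1$ for all $s\in S$ and $st=ts$ whenever $s,t$ are adjacent vertices. For an induced subgraph $\Lambda$ of $\Gamma$, $G_\Lambda$ is the (special) subgroup generated by the vertices of $\Lambda$; its conjugates are called parabolic subgroups. The listed members of the collection $\mathcal{H}$ are understood to be $n$ pairwise distinct subgroups. Almost malnormal collection: a collection $\mathcal{H}$ of subgroups of $G$ is almost malnormal if for all $H,H'\in\mathcal{H}$ and $g\in G$, $|H\cap gH'g^{-1}|=\infty$ implies $H=H'$ and $g\in H$. Hyperbolically embedded (Dahmani–Guirardel–Osin): a collection $\{H_\lambda\}$ of subgroups of $G$ is hyperbolically embedded in $G$ if there is a subset $X\subset G$ such that $X\cup\bigcup_\lambda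 H_\lambda$ generates $G$ and: (i) the Cayley graph $\mathrm{Cay}(G,X\sqcup\bigsqcup_\lambda H_\lambda)$ (letters from different pieces of the disjoint union being regarded as distinct) is Gromov hyperbolic; (ii) for every $\lambda$, the metric $\hat d_\lambda\colon H_\lambda\times H_\lambda\to[0,\infty]$ is locally finite (all balls of finite radius are finite), where $\hat d_\lambda(h,k)$ is the length of a shortest path from $h$ to $k$ in this Cayley graph that uses no edge of the complete subgraph $\mathrm{Cay}(H_\lambda,H_\lambda)$ (the edges joining elements of $H_\lambda$ and labelled by letters of $H_\lambda$), and $\hat d_\lambda(h,k)=\infty$ if there is no such path. *)

(* Defs.v *)
From HB Require Import structures.
From mathcomp Require Import all_boot.
From mathcomp Require Import boolp classical_sets cardinality.

Set Implicit Arguments.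
Unset Strict Implicit.
Unset Printing Implicit Defensive.

Local Open Scope classical_set_scope.
Local Open Scope group_scope.
Local Open Scope quotient_scope.

(* The congruence on words over the vertices generated by the defining
   relations. The generators being involutions, the quotient monoid is the
   group with this presentation, the inverse of a word being its reversal. *)
Inductive racg_cong (T : finType) (e : rel T) : seq T -> seq T -> Prop :=
| RacgInvol s : racg_cong e [:: s; s] [::]
| RacgComm s t : e s t -> racg_cong e [:: s; t] [:: t; s]
| RacgRefl u : racg_cong e u u
| RacgSym u v : racg_cong e u v -> racg_cong e v u
| RacgTrans v u w : racg_cong e u v -> racg_cong e v w -> racg_cong e u w
| RacgCat u u' v v' :
    racg_cong e u u' -> racg_cong e v v' -> racg_cong e (u ++ v) (u' ++ v').

Definition racg_congb (T : finType) (e : rel T) : rel (seq T) :=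
  fun u v => `[< racg_cong e u v >].

Lemma racg_congb_equiv (T : finType) (e : rel T) :
  equiv_class_of (racg_congb e).
Proof.
split=> [u | u v | v u w].
- exact/asboolP/RacgRefl.
- by apply/asboolP/asboolP; apply: RacgSym.
- by move=> /asboolP uv /asboolP vw; apply/asboolP/(RacgTrans uv vw).
Qed.

Canonical racg_equiv (T : finType) (e : rel T) :=
  EquivRelPack (racg_congb_equiv e).

Definition racg (T : finType) (e : rel T) := {eq_quot (racg_equiv e)}.

HB.instance Definition _ (T : finType) (e : rel T) :=
  Choice.copy (racg e) {eq_quot (racg_equiv e)}.

Definition racg_word (T : finType) (e : rel T) (u : seq T) : racg e :=
  \pi_{eq_quot (racg_equiv e)} u.

Definition racg_repr (T : finType) (e : rel T) (x : racg e) : seq T :=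
  repr (x : {eq_quot (racg_equiv e)}).

Lemma racg_wordP (T : finType) (e : rel T) (u v : seq T) :
  racg_word e u = racg_word e v <-> racg_cong e u v.
Proof.
rewrite /racg_word; split=> [/eqmodP /asboolP // | uv].
exact/eqmodP/asboolP.
Qed.

Lemma racg_reprK (T : finType) (e : rel T) (x : racg e) :
  racg_word e (racg_repr x) = x.
Proof. exact: reprK. Qed.

Lemma racg_reprP (T : finType) (e : rel T) (u : seq T) :
  racg_cong e (racg_repr (racg_word e u)) u.
Proof. by apply/racg_wordP; rewrite racg_reprK. Qed.

Lemma racg_cong_rev (T : finType) (e : rel T) (u v : seq T) :
  racg_cong e u v -> racg_cong e (rev u) (rev v).
Proof.
elim=> {u v} [s | s t est | u | u v _ IH | v u w _ IH1 _ IH2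
             | u u' v v' _ IH1 _ IH2].
- exact: RacgInvol.
- exact/RacgSym/RacgComm.
- exact: RacgRefl.
- exact: RacgSym.
- exact: RacgTrans IH1 IH2.
- by rewrite !rev_cat; apply: RacgCat.
Qed.

Lemma racg_cong_revK (T : finType) (e : rel T) (u : seq T) :
  racg_cong e (rev u ++ u) [::].
Proof.
elim: u => [|s u IH]; first exact: RacgRefl.
rewrite rev_cons cat_rcons; apply: RacgTrans IH.
apply: RacgCat; first exact: RacgRefl.
by apply: (@RacgCat _ e [:: s; s] [::] u u); [apply: RacgInvol | apply: RacgRefl].
Qed.

Definition racg_mul (T : finType) (e : rel T) (x y : racg e) : racg e :=
  racg_word e (racg_repr x ++ racg_repr y).

Definition racg_inv (T : finType) (e : rel T) (x : racg e) : racg e :=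
  racg_word e (rev (racg_repr x)).

Lemma racg_mulA (T : finType) (e : rel T) : associative (@racg_mul T e).
Proof.
move=> x y z; apply/racg_wordP.
apply: (@RacgTrans _ _ (racg_repr x ++ (racg_repr y ++ racg_repr z))).
  by apply: RacgCat; [apply: RacgRefl | apply: racg_reprP].
rewrite catA; apply: RacgCat; last exact: RacgRefl.
exact/RacgSym/racg_reprP.
Qed.

Lemma racg_mul1 (T : finType) (e : rel T) :
  left_id (racg_word e [::]) (@racg_mul T e).
Proof.
move=> x; rewrite -[RHS]racg_reprK; apply/racg_wordP.
rewrite -[X in racg_cong _ _ X]cat0s.
by apply: RacgCat; [apply: racg_reprP | apply: RacgRefl].
Qed.

Lemma racg_mulr1 (T : finType) (e : rel T) :
  right_id (racg_word e [::]) (@racg_mul T e).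
Proof.
move=> x; rewrite -[RHS]racg_reprK; apply/racg_wordP.
rewrite -[X in racg_cong _ _ X]cats0.
by apply: RacgCat; [apply: RacgRefl | apply: racg_reprP].
Qed.

Lemma racg_mulV (T : finType) (e : rel T) :
  left_inverse (racg_word e [::]) (@racg_inv T e) (@racg_mul T e).
Proof.
move=> x; apply/racg_wordP; apply: RacgTrans (racg_cong_revK e (racg_repr x)).
by apply: RacgCat; [apply: racg_reprP | apply: RacgRefl].
Qed.

Lemma racg_mulrV (T : finType) (e : rel T) :
  right_inverse (racg_word e [::]) (@racg_inv T e) (@racg_mul T e).
Proof.
move=> x; apply/racg_wordP.
apply: RacgTrans (racg_cong_revK e (rev (racg_repr x))).
by rewrite revK; apply: RacgCat; [apply: RacgRefl | apply: racg_reprP].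
Qed.

HB.instance Definition _ (T : finType) (e : rel T) :=
  isGroup.Build (racg e) (@racg_mulA T e) (@racg_mul1 T e) (@racg_mulr1 T e)
    (@racg_mulV T e) (@racg_mulrV T e).

Definition racg_gen (T : finType) (e : rel T) (s : T) : racg e :=
  racg_word e [:: s].

Definition is_subgroup (G : groupType) (K : set G) : Prop :=
  K 1 /\ forall x y, K x -> K y -> K (x * y^-1).

Definition generated (G : groupType) (A : set G) : set G :=
  smallest (@is_subgroup G) A.

Definition conj_set (G : groupType) (g : G) (K : set G) : set G :=
  [set g * x * g^-1 | x in K].

(* Induced subgraphs are given by their vertex sets. *)
Definition special_subgroup (T : finType) (e : rel T) (L : {set T}) :
    set (racg e) :=
  generated [set x | exists2 s, s \in L & x = racg_gen e s].
Arguments special_subgroup {T} e L.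

Definition parabolic (T : finType) (e : rel T) (g : racg e) (L : {set T}) :
    set (racg e) :=
  conj_set g (special_subgroup e L).
Arguments parabolic {T e} g L.

Definition clique (T : finType) (e : rel T) (A : {set T}) : Prop :=
  {in A &, forall u v, u != v -> e u v}.

Definition almost_malnormal (G : groupType) (I : Type) (H : I -> set G) : Prop :=
  forall (i j : I) (g : G),
    infinite_set (H i `&` conj_set g (H j)) -> H i = H j /\ H i g.

(* Here and below a graph is a relation [r] on its vertex set [V]. *)
Fixpoint walk (V : Type) (r : V -> V -> Prop) (n : nat) (x y : V) : Prop :=
  if n is m.+1 then exists2 z, r x z & walk r m z y else x = y.

(* [None] stands for an infinite distance. *)
Definition graph_dist (V : Type) (r : V -> V -> Prop) (x y : V) : option nat :=
  if pselect (exists n, `[< walk r n x y >]) is left ex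
  then Some (ex_minn ex) else None.

Definition dist_le (V : Type) (r : V -> V -> Prop) (x y : V) (n : nat) : Prop :=
  exists2 d, graph_dist r x y = Some d & d <= n.

Definition geodesic (V : Type) (r : V -> V -> Prop) (x y : V) (n : nat)
    (p : nat -> V) : Prop :=
  [/\ graph_dist r x y = Some n, p 0 = x, p n = y
    & forall i, i < n -> r (p i) (p i.+1)].

(* Uniform slimness of geodesic triangles, with vertices and points taken in
   the vertex set; passing to the geometric realization only changes the
   constant [delta]. *)
Definition gromov_hyperbolic (V : Type) (r : V -> V -> Prop) : Prop :=
  exists delta : nat, forall x y z a b c p q s,
    geodesic r x y a p -> geodesic r y z b q -> geodesic r x z c s ->
    forall i, i <= a ->
      (exists2 j, j <= b & dist_le r (p i) (q j) delta) \/
      (exists2 j, j <= c & dist_le r (p i) (s j) delta).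

(* The pieces of the alphabet X ⊔ ⊔_i H_i are indexed by [option I], [None]
   being the index of X. *)
Definition letters (G : groupType) (I : Type) (X : set G) (H : I -> set G)
    (l : option I) : set G :=
  if l is Some i then H i else X.

(* Edges can be traversed in both directions: X need not be symmetric. *)
Definition cayley_edge (G : groupType) (I : Type) (X : set G) (H : I -> set G)
    (l : option I) (x y : G) : Prop :=
  exists2 a, letters X H l a & y = x * a \/ x = y * a.

Definition cayley_adj (G : groupType) (I : Type) (X : set G) (H : I -> set G)
    (x y : G) : Prop :=
  exists l, cayley_edge X H l x y.

(* Adjacency in the Cayley graph deprived of the edges of Cay(H_i, H_i). *)
Definition hat_adj (G : groupType) (I : Type) (X : set G) (H : I -> set G)
    (i : I) (x y : G) : Prop :=
  exists2 l, cayley_edge X H l x y & ~ [/\ l = Some i, H i x & H i y].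

Definition hyperbolically_embedded (G : groupType) (I : Type)
    (H : I -> set G) : Prop :=
  exists X : set G,
    [/\ generated (X `|` \bigcup_i H i) = setT,
        gromov_hyperbolic (cayley_adj X H)
      & forall i h n, H i h ->
          finite_set [set k | H i k /\ dist_le (hat_adj X H i) h k n]].

(* Main.v *)
From Stdlib Require Import BinInt.
Require Import Defs.
From mathcomp Require Import all_boot.
From mathcomp Require Import boolp classical_sets cardinality.
From mathcomp Require Import zify.

Set Implicit Arguments.
Unset Strict Implicit.
Unset Printing Implicit Defensive.

(* The wall of a reflection [t] separates [x] from [y] when [side x t] differs
   from [side y t]; the cosets [h P_i] are crossed by the walls of the
   reflections of [h P_i h^-1].

   The combinatorial input is that two walls cutting the group into four
   nonempty quadrants commute.  Together with conditions (1) and (2) it shows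
   that two distinct cosets are never crossed by the same two non-commuting
   walls, and that a wall commuting with two non-commuting walls of a coset
   crosses that coset.

   For the relative generating set X take the elements [x] such that, for each
   coset, the walls of this coset separating [1] from [x] pairwise commute.
   The intervals of the median graph of the group then form thin triangles in
   Cay(G, X u H): if [v] lies between [x] and [z], every wall separating [v]
   from its median with [x, y] crosses every wall separating it from its median
   with [y, z], so that [v] is adjacent to one of these medians or both are
   separated from [v] by one and the same coset.  Bowditch's criterion gives
   hyperbolicity.  The metrics [hat d_i] are locally finite because an edge
   outside Cay(H_i, H_i) crosses boundedly many walls of [H_i].

   Conversely, local finiteness of [hat d_i] gives almost malnormality, and
   almost malnormality, tested on an infinite dihedral group <u, v>, gives (1)
   and (2). *)

(** * Bowditch's criterion *)

Section Graphs.
Variables (V : Type) (r : V -> V -> Prop).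
Hypothesis r_sym : forall x y, r x y -> r y x.

Definition dle (n : nat) (x y : V) : Prop := exists2 m, m <= n & walk r m x y.

Lemma walk_cat m n x y z : walk r m x y -> walk r n y z -> walk r (m + n) x z.
Proof.
by elim: m x => [x ->//|m IH x [w xw wy] yz]; exists w => //; apply: IH.
Qed.

Lemma walk_sym n x y : walk r n x y -> walk r n y x.
Proof.
elim: n x y => [|n IH] x y; first by move=> /= ->.
move=> [z xz /IH zy]; rewrite -addn1; apply: (walk_cat zy).
by exists x => //; apply: r_sym.
Qed.

Lemma dle_refl n x : dle n x x.
Proof. by exists 0. Qed.

Lemma dle_sym n x y : dle n x y -> dle n y x.
Proof. by case=> m mn /walk_sym; exists m. Qed.

Lemma dle_trans m n x y z : dle m x y -> dle n y z -> dle (m + n) x z.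
Proof.
by case=> m' mm xy [n' nn yz]; exists (m' + n'); [apply: leq_add | apply: walk_cat yz].
Qed.

Lemma dle_le m n x y : m <= n -> dle m x y -> dle n x y.
Proof. by move=> mn [k km w]; exists k => //; apply: leq_trans mn. Qed.

Lemma dle1 x y : r x y -> dle 1 x y.
Proof. by move=> xy; exists 1 => //; exists y. Qed.

Lemma dist_leP x y n : dist_le r x y n <-> dle n x y.
Proof.
rewrite /dist_le /graph_dist; case: pselect => [ex|nex].
  case: ex_minnP => m /asboolP w min; split.
    by case=> d [<-] mn; exists m.
  case=> k kn wk; exists m => //; apply: leq_trans kn.
  by apply: min; apply/asboolP.
split; first by case.
by case=> m _ w; case: nex; exists m; apply/asboolP.
Qed.

Lemma walk_path n x y : walk r n x y <->
  exists p : nat -> V, [/\ p 0 = x, p n = y & forall i, i < n -> r (p i) (p i.+1)].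
Proof.
elim: n x => [|n IH] x /=.
  by split=> [->|[p [<- <-]]] //; exists (fun=> y).
split=> [[z xz /IH[p [p0 pn pr]]]|[p [p0 pn pr]]].
  exists (fun i => if i is j.+1 then p j else x); split=> //.
  by case=> [_|i] /=; [rewrite p0 | apply: pr].
exists (p 1); first by rewrite -p0; apply: pr.
by apply/IH; exists (fun i => p i.+1); split=> // i ni; apply: pr.
Qed.

Lemma path_walk (p : nat -> V) n : (forall i, i < n -> r (p i) (p i.+1)) ->
  forall i j, i <= j <= n -> walk r (j - i) (p i) (p j).
Proof.
move=> pr i j /andP[ij jn]; apply/walk_path; exists (fun k => p (i + k)); split.
- by rewrite addn0.
- by rewrite subnKC.
- by move=> k kj; rewrite addnS; apply: pr; lia.
Qed.

Lemma geodesic_le x y n p i j m : geodesic r x y n p -> i <= j <= n ->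
  dle m (p i) (p j) -> j - i <= m.
Proof.
move=> [D p0 pn pr] /andP[ij jn] [k km w].
have iw : walk r i x (p i).
  by have := path_walk pr (i := 0) (j := i); rewrite subn0 p0; apply; lia.
have jw : walk r (n - j) (p j) y.
  by have := path_walk pr (i := j) (j := n); rewrite pn; apply; lia.
have W := walk_cat (walk_cat iw w) jw.
have : dle (i + k + (n - j)) x y by exists (i + k + (n - j)).
move=> /dist_leP[d]; rewrite D => -[<-]; lia.
Qed.

(* A family of "intervals" spanned by the pairs of vertices; hyperbolicity
   follows, by Bowditch's criterion, if their triangles are thin. *)
Variable I : V -> V -> V -> Prop.
Hypothesis I_walk : forall x z, exists n p, [/\ p 0 = x, p n = z,
  forall i, i < n -> r (p i) (p i.+1) & forall i, i <= n -> I x z (p i)].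
Hypothesis I_sub : forall x z v x' z', I x z v -> I x v x' -> I v z z' ->
  [/\ I x' z' v, I x z x' & I x z z'].
Hypothesis I_sym : forall x z v, I x z v -> I z x v.
Hypothesis I_end : forall x z, I x z x.
Variable D : nat.
Hypothesis I_refl : forall x v, I x x v -> v = x.
Hypothesis I_edge : forall x z v, r x z -> I x z v -> dle D v x \/ dle D v z.
Hypothesis I_thin : forall x y z v, I x z v ->
  exists w, (I x y w \/ I y z w) /\ dle D v w.

(** By halving the path: the triangle on [p 0], the midpoint and [p n] moves [v] by at most [D] into
    the interval of one half. After [k] halvings at most an edge is left, where [I_edge] or [I_refl]
    applies. *)
Lemma log_interval k n p : n <= 2 ^ k -> (forall i, i < n -> r (p i) (p i.+1)) ->
  forall v, I (p 0) (p n) v -> exists2 i, i <= n & dle (D * k.+1) v (p i).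
Proof.
elim: k n p => [|k IH] n p nk pr v Iv.
  case: n nk pr Iv => [|[|//]] _ pr Iv.
    by exists 0 => //; rewrite (I_refl Iv); apply: dle_refl.
  by case: (I_edge (pr 0 isT) Iv); [exists 0 | exists 1] => //; rewrite muln1.
pose m := n./2.
have mE : m <= 2 ^ k by rewrite /m; move: nk; rewrite expnS; lia.
have mE' : n - m <= 2 ^ k by rewrite /m; move: nk; rewrite expnS; lia.
have mn : m <= n by rewrite /m; lia.
have [w [Iw vw]] := I_thin (p m) Iv.
have dE : D * k.+2 = D + D * k.+1 by lia.
case: Iw => Iw.
  have [|i im wi] := IH m p mE _ w Iw; first by move=> i im; apply: pr; lia.
  by exists i; [lia | rewrite dE; apply: dle_trans wi].
have [||i im wi] := IH (n - m) (fun i => p (m + i)) mE' _ w.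
- by move=> i im; rewrite addnS; apply: pr; lia.
- by rewrite addn0 subnKC.
by exists (m + i); [lia | rewrite dE; apply: dle_trans wi].
Qed.

Lemma log_interval_walk k n x z v : n <= 2 ^ k -> walk r n x z -> I x z v ->
  exists w i j, [/\ dle (D * k.+1) v w, walk r i x w, walk r j w z & i + j = n].
Proof.
move=> nk /walk_path[p [p0 pn pr]]; rewrite -p0 -pn => Iv.
have [i ij vi] := log_interval nk pr Iv.
exists (p i), i, (n - i); split=> //; last by lia.
  by have := path_walk pr (i := 0) (j := i); rewrite subn0; apply; lia.
by apply: (path_walk pr); lia.
Qed.

(** Chosen so that [8 * D * (q + 1) + 2 <= (q - 3) ^ 2] for all [q >= log_bound]. *)
Definition log_bound : nat := 8 * D + 20.

(** The hypothesis bounds [R] by a multiple of its own logarithm. If [R] were larger, let [q] be the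
    quotient of [R - 1] by [D]; then [k = q - 3] satisfies the premise and gives
    [R <= D * q <= R - 1]. *)
Lemma log_bound_lt R : (forall k, 8 * R + 2 <= 2 ^ k -> R <= D * (k + 3)) -> R <= D * log_bound.
Proof.
have sq k : 4 <= k -> k * k <= 2 ^ k.
  elim: k => // k IH; rewrite leq_eqVlt => /orP[/eqP<- //|k4].
  by rewrite expnS; have := IH k4; nia.
move=> H; rewrite leqNgt; apply/negP => RD.
have D0 : 0 < D.
  rewrite lt0n; apply/eqP => D0.
  have /H : 8 * R + 2 <= 2 ^ (8 * R + 4) by have := sq (8 * R + 4); nia.
  by rewrite D0 mul0n; lia.
pose q := R.-1 %/ D.
have qle : q * D <= R.-1 by apply: leq_trunc_div.
have qlt : R.-1 < q.+1 * D by apply: ltn_ceil.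
have qge : log_bound <= q by rewrite leq_divRL //; lia.
have kE : q - 3 + 3 = q by rewrite /log_bound in qge; lia.
have /H : 8 * R + 2 <= 2 ^ (q - 3); last by rewrite kE; lia.
rewrite /log_bound in qge; apply: leq_trans (sq _ _); last by lia.
have : R <= q.+1 * D by lia.
have : (q - 3) * (8 * D + 17) <= (q - 3) * (q - 3) by apply: leq_mul; lia.
nia.
Qed.

(** Follow the interval from [v] to [y] up to the first vertex farther than [2 * rho] from [v]. If
    there is none, take [y] itself, which already lies on [p]; hence the alternative [m = 0]. *)
Lemma interval_exit (rho n : nat) (p : nat -> V) v y i0 : i0 <= n -> p i0 = y ->
  (forall y', I y v y' -> exists2 i, i <= n & dle rho y' (p i)) ->
  exists y' i m, [/\ i <= n, I y v y', dle (2 * rho + 1) v y', m <= rho &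
    walk r m y' (p i) /\ (m = 0 \/ ~ dle (2 * rho) v y')].
Proof.
move=> i0n pi0 H; have [m [q [q0 qm qr qI]]] := I_walk v y.
have [[j]|all_close] := pselect (exists j, `[< j <= m /\ ~ dle (2 * rho) v (q j) >]).
  move=> Ej; have ex : exists j, `[< j <= m /\ ~ dle (2 * rho) v (q j) >] by exists j.
  case: (ex_minnP ex) => {Ej}j /asboolP[jm jfar] min.
  have Ij : I y v (q j) by apply/I_sym/qI.
  have [i i_n [k krho w]] := H _ Ij.
  exists (q j), i, k; split=> //; last by split=> //; right.
  case: j jm jfar min {w Ij} => [_ []|j jm jfar min]; first by rewrite q0; apply: dle_refl.
  apply: (dle_trans (y := q j)); last by apply: dle1; apply: qr.
  apply: contrapT => nd; suff /min : `[< j <= m /\ ~ dle (2 * rho) v (q j) >] by rewrite ltnn.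
  by apply/asboolP; split=> //; apply: ltnW.
exists y, i0, 0; split=> //=; [| by split=> //; left].
apply: (dle_le (m := 2 * rho)); first by lia.
by apply: contrapT => nd; apply: all_close; exists m; apply/asboolP; rewrite qm.
Qed.

Definition fellow_bound : nat := D * log_bound.

(** Take the least constant [rho] that works and a vertex [v] nearly realizing it. Exit points [x']
    and [z'] on both sides of [v] are joined by a path going to the geodesic, along it and back. Its
    three pieces have length linear in [rho], so one comes logarithmically close to [v], while all
    of them avoid a large ball around [v]. *)
Lemma interval_near_geodesic x z n p : geodesic r x z n p ->
  forall v, I x z v -> exists2 i, i <= n & dle fellow_bound v (p i).
Proof.
move=> geo; have [_ p0 pn pr] := geo.
pose near rho := forall v, I x z v -> exists2 i, i <= n & dle rho v (p i).
have ex : exists rho, `[< near rho >].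
  exists (D * n.+1); apply/asboolP => v; rewrite -p0 -pn.
  by apply: log_interval => //; apply: ltnW; apply: ltn_expl.
case: (ex_minnP ex) => rho /asboolP near_rho min.
suff le : rho <= fellow_bound.
  by move=> v /near_rho[i i_n vi]; exists i => //; apply: dle_le vi.
(* From here on the least constant is [rho.+1], so some [v] is farther than [rho] from the whole
   geodesic. *)
apply: log_bound_lt => k rk; case: rho => [//|rho] in near_rho min rk *.
have [v [Iv far]] : exists v, I x z v /\ forall i, i <= n -> ~ dle rho v (p i).
  apply: contrapT => H; have : near rho; last by move/asboolP/min; rewrite ltnn.
  move=> v Iv; apply: contrapT => H'; case: H; exists v; split=> // i i_n vi.
  by case: H'; exists i.
have [x' [i [a [i_n Ix' vx' ar [xa farx]]]]] := @interval_exit rho.+1 n p v x 0 isT p0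
  (fun y Iy => near_rho _ (let: And3 _ h _ := I_sub Iv Iy (I_end v z) in h)).
have Iz y : I z v y -> I v z y by apply: I_sym.
have [z' [j [b [j_n Iz' vz' br [zb farz]]]]] := @interval_exit rho.+1 n p v z n (leqnn n) pn
  (fun y Iy => near_rho _ (let: And3 _ _ h := I_sub Iv (I_sym (I_end v x)) (Iz _ Iy) in h)).
have [Iv' _ _] := I_sub Iv Ix' (Iz _ Iz').
(* The connecting walk has length at most [rho.+1] and starts farther than [2 * rho.+1] from [v], or
   it is a single vertex of the geodesic. Either way it stays farther than [rho] from [v]. *)
have side_walk y' l m : l <= n -> m <= rho.+1 -> walk r m y' (p l) ->
    m = 0 \/ ~ dle (2 * rho.+1) v y' ->
    forall w d, I y' (p l) w \/ I (p l) y' w -> dle d v w -> rho.+1 <= d + D * k.+1.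
  move=> l_n mr yp fy w d Iw vw; rewrite leqNgt; apply/negP => lt.
  have {}Iw : I y' (p l) w by case: Iw => // /I_sym.
  have [|u [m1 [m2 [wu yu up mE]]]] := log_interval_walk (k := k) _ yp Iw; first by lia.
  have vu := dle_trans vw wu.
  case: fy => [m0|]; last first.
    apply; apply: dle_sym; apply: (dle_le (m := m1 + (d + D * k.+1))); first by lia.
    by apply: dle_trans (dle_sym vu); exists m1.
  apply: (far l l_n); apply: (dle_le (m := d + D * k.+1)); first by lia.
  have m20 : m2 = 0 by lia.
  by move: up; rewrite m20 /= => <-.
(* Two triangles fill the quadrilateral [x'], [p i], [p j], [z'], so [v] is within [D + D] of the
   interval of a side other than the one from [x'] to [z']. *)
have [w [[Iw|Iw] vw]] := I_thin (p i) Iv'.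
  by have := side_walk x' i a i_n ar xa farx w D (or_introl Iw) vw; lia.
have [w' [[Iw'|Iw'] ww']] := I_thin (p j) Iw; last first.
  by have := side_walk z' j b j_n br zb farz w' (D + D) (or_intror Iw') (dle_trans vw ww'); lia.
have dij : dle (8 * rho.+1 + 2) (p i) (p j).
  have x'p : dle rho.+1 (p i) x' by apply: dle_sym; exists a.
  have z'p : dle rho.+1 z' (p j) by exists b.
  apply: dle_le (dle_trans x'p (dle_trans (dle_sym vx') (dle_trans vz' z'p))); lia.
have middle l l' u : l <= l' <= n -> dle (8 * rho.+1 + 2) (p l) (p l') -> I (p l) (p l') u ->
    dle (D + D) v u -> rho.+1 <= D + D + D * k.+1.
  move=> /andP[ll' l'n] dl Iu vu; rewrite leqNgt; apply/negP => lt.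
  have le : l' - l <= 2 ^ k by apply: leq_trans rk; apply: (geodesic_le geo) => //; apply/andP.
  have [|| t tl ut] := log_interval le (p := fun t => p (l + t)) _ (v := u).
  - by move=> t tl; rewrite addnS; apply: pr; lia.
  - by rewrite addn0 subnKC.
  apply: (far (l + t)); first by lia.
  by apply: dle_le (dle_trans vu ut); lia.
have {ww'}vw' := dle_trans vw ww'.
have : rho.+1 <= D + D + D * k.+1; last by lia.
case: (leqP i j) => ij.
  by apply: (middle i j w') => //; apply/andP.
by apply: (middle j i w') => //; [lia | apply: dle_sym | apply: I_sym].
Qed.

(** A connectedness argument: along a walk inside the interval, the first vertex close to some [p j]
    with [i <= j] is also close, through its predecessor, to some [p j'] with [j' <= i]. Then
    [j - j'] is at most [2 * fellow_bound + 1], and [p i] lies in between. *)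
Lemma geodesic_near_interval x z n p : geodesic r x z n p ->
  forall i, i <= n -> exists2 v, I x z v & dle (3 * fellow_bound + 1) v (p i).
Proof.
move=> geo i i_n; have [_ p0 pn pr] := geo.
have [m [q [q0 qm qr qI]]] := I_walk x z.
pose past k := exists j, [/\ i <= j, j <= n & dle fellow_bound (q k) (p j)].
have pm : past m by exists n; split=> //; rewrite qm pn; apply: dle_refl.
have ex : exists k, `[< past k >] by exists m; apply/asboolP.
case: (ex_minnP ex) => k /asboolP[j [ij jn kj]] min.
have km : k <= m by apply: min; apply/asboolP.
exists (q k); first exact: qI.
have [j' [j'i kj']] : exists j', j' <= i /\ dle (fellow_bound + 1) (q k) (p j').
  case: k km min kj => [_ _ _|k km min kj].
    by exists 0; split=> //; rewrite q0 p0; apply: dle_refl.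
  have [j' j'n kj'] := interval_near_geodesic geo (qI k (ltnW km)).
  exists j'; split.
    rewrite leqNgt; apply/negP => ij'.
    suff /min : `[< past k >] by rewrite ltnn.
    by apply/asboolP; exists j'; split=> //; apply: ltnW.
  rewrite addnC; apply: dle_trans kj'; apply: dle_sym; apply: dle1; exact: qr.
have jj' : j - j' <= fellow_bound + 1 + fellow_bound.
  apply: (geodesic_le geo); first by lia.
  exact: dle_trans (dle_sym kj') kj.
apply: (dle_le (m := fellow_bound + (j - i))); first by lia.
apply: dle_trans kj _; apply: dle_sym; exists (j - i) => //.
by apply: (path_walk pr); lia.
Qed.

Lemma thin_intervals_hyperbolic : gromov_hyperbolic r.
Proof.
(* From the geodesic to its interval costs [3 * fellow_bound + 1], to another interval [D], and back
   to a geodesic [fellow_bound]. *)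
exists (4 * fellow_bound + 1 + D) => x y z a b c p q s geop geoq geos i ia.
have [v Iv vi] := geodesic_near_interval geop ia.
have [w [[Iw|Iw] vw]] := I_thin z Iv.
  right; have [j jc wj] := interval_near_geodesic geos Iw.
  exists j => //; apply/dist_leP; apply: dle_le (dle_trans (dle_sym vi) (dle_trans vw wj)); lia.
left; have [j jb wj] := interval_near_geodesic geoq (I_sym Iw).
exists j => //; apply/dist_leP; apply: dle_le (dle_trans (dle_sym vi) (dle_trans vw wj)); lia.
Qed.

End Graphs.

(** * Words, walls and reduced words *)

Section Words.
Local Open Scope group_scope.
Variables (T : finType) (e : rel T).

Notation G := (racg e).
Notation word := (racg_word e).
Notation gen := (racg_gen e).

Lemma racg_word_ind (P : G -> Prop) : (forall u, P (word u)) -> forall x, P x.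
Proof. by move=> Pw x; rewrite -(racg_reprK x). Qed.

Lemma racg_word_nil : word [::] = 1.
Proof. by []. Qed.

Lemma racg_word_cat u v : word (u ++ v) = word u * word v.
Proof.
by apply/racg_wordP; apply: RacgCat; apply: RacgSym; apply: racg_reprP.
Qed.

Lemma racg_word_cons s u : word (s :: u) = gen s * word u.
Proof. exact: (racg_word_cat [:: s]). Qed.

Lemma racg_word_rcons u s : word (rcons u s) = word u * gen s.
Proof. by rewrite -cats1 racg_word_cat. Qed.

Lemma racg_gen2 s : gen s * gen s = 1.
Proof. by rewrite -racg_word_cat; apply/racg_wordP/RacgInvol. Qed.

Lemma racg_genV s : (gen s)^-1 = gen s.
Proof. by rewrite -[LHS]mulg1 -(racg_gen2 s) mulKg. Qed.

Lemma racg_genK s : (forall x, x * gen s * gen s = x) * (forall x, gen s * (gen s * x) = x).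
Proof. by split=> x; rewrite -1?mulgA ?racg_gen2 ?mulg1 // mulgA racg_gen2 mul1g. Qed.

Lemma racg_gen_commute s t : e s t -> commute (gen s) (gen t).
Proof. by move=> est; rewrite /commute -!racg_word_cat; apply/racg_wordP/RacgComm. Qed.

Fixpoint word_act (A : Type) (f : T -> A -> A) (u : seq T) (a : A) : A :=
  if u is s :: u' then f s (word_act f u' a) else a.

Lemma word_act_cat A (f : T -> A -> A) u v a :
  word_act f (u ++ v) a = word_act f u (word_act f v a).
Proof. by elim: u => //= s u ->. Qed.

(** Such an [f] respects the defining relations, hence is an action of the group. Particular actions
    serve below to tell group elements apart. *)
Lemma word_act_eq A (f : T -> A -> A) :
  (forall s, involutive (f s)) ->
  (forall s t a, e s t -> f s (f t a) = f t (f s a)) ->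
  forall u v a, word u = word v -> word_act f u a = word_act f v a.
Proof.
move=> f2 fC u v a /racg_wordP uv.
elim: {u v} uv a => [s a|s t est a|//|u v _ IH a|v u w _ IH1 _ IH2 a
  |u u' v v' _ IH1 _ IH2 a] /=.
- exact: f2.
- exact: fC.
- by rewrite IH.
- by rewrite IH1.
- by rewrite !word_act_cat IH2 IH1.
Qed.

(* The parity of the number of occurrences of [t] among the reflections
   [s1 .. si .. s1]; it tells whether the wall of [t] separates [1] from
   [word u], and makes sense for an arbitrary element [t]. *)
Fixpoint word_side (u : seq T) (t : G) : bool :=
  if u is s :: u' then (t == gen s) (+) word_side u' (t ^ gen s) else false.

Lemma word_side_cat u v t :
  word_side (u ++ v) t = word_side u t (+) word_side v (t ^ word u).
Proof.
elim: u t => [|s u IH] t /=; first by rewrite conjg1.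
by rewrite IH addbA racg_word_cons conjgM.
Qed.

Lemma conjg_gen_eq s (t x : G) : (t ^ gen s == x) = (t == x ^ gen s).
Proof. by rewrite -(inj_eq (conjg_inj (gen s))) -conjgM racg_gen2 conjg1. Qed.

Lemma word_side_eq u v : word u = word v -> word_side u =1 word_side v.
Proof.
move/racg_wordP; elim=> {u v} [s t|s t est x|//|u v _ IH x|v u w _ IH1 _ IH2 x
  |u u' v v' uu' IH1 vv' IH2 x] /=.
- by rewrite conjg_gen_eq conjgE racg_gen2 mulg1 racg_genV addbF addbb.
- have C := racg_gen_commute est.
  rewrite !conjg_gen_eq !addbF.
  have -> : gen t ^ gen s = gen t by rewrite conjgE -C mulKg.
  have -> : gen s ^ gen t = gen s by rewrite conjgE C mulKg.
  by rewrite addbC.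
- by rewrite IH.
- by rewrite IH1.
- by rewrite !word_side_cat IH1 IH2; move/racg_wordP: uu' => ->.
Qed.

Definition side (x t : G) : bool := word_side (racg_repr x) t.

Lemma side_word u t : side (word u) t = word_side u t.
Proof. by apply: word_side_eq; rewrite racg_reprK. Qed.

(** The cocycle rule: a path from [1] to [x * y] through [x] crosses the wall of [t] before or after
    [x], and translating by [x^-1] turns [t] into [t ^ x]. *)
Lemma sideM x y t : side (x * y) t = side x t (+) side y (t ^ x).
Proof.
elim/racg_word_ind: x => u; elim/racg_word_ind: y => v.
by rewrite -racg_word_cat !side_word word_side_cat.
Qed.

Lemma side1 t : side 1 t = false.
Proof. by rewrite -racg_word_nil side_word. Qed.

Lemma side_gen s t : side (gen s) t = (t == gen s).
Proof. by rewrite side_word /= addbF. Qed.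

Lemma side_mul_gen x s t : side (x * gen s) t = side x t (+) (t ^ x == gen s).
Proof. by rewrite sideM side_gen. Qed.

Lemma sideV x t : side x^-1 t = side x (t ^ x^-1).
Proof.
have := sideM x x^-1 (t ^ x^-1); rewrite mulgV side1 conjgKV.
by case: side; case: side.
Qed.

Lemma side_mulV x y t : side (x^-1 * y) t = side x (t ^ x^-1) (+) side y (t ^ x^-1).
Proof. by rewrite sideM sideV. Qed.

Definition reflection (t : G) : Prop := exists x s, t = gen s ^ x.

Lemma reflection2 t : reflection t -> t * t = 1.
Proof. by case=> x [s ->]; rewrite -conjMg racg_gen2 conj1g. Qed.

Lemma conjg_self (t : G) : t ^ t = t.
Proof. by rewrite conjgE mulKg. Qed.

Lemma side_reflection t : reflection t -> side t t.
Proof.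
case=> x [s ->]; rewrite {1}conjgE sideM sideV conjgK sideM side_gen eqxx conjg_self.
by case: side.
Qed.

Lemma side_reflM t x : reflection t -> side (t * x) t = ~~ side x t.
Proof. by move=> rt; rewrite sideM side_reflection // conjg_self. Qed.

Lemma word_side_split u t : word_side u t ->
  exists u1 s u2, u = u1 ++ s :: u2 /\ t = gen s ^ (word u1)^-1.
Proof.
elim: u t => //= s u IH t; case: (eqVneq t (gen s)) => [-> _|_ /= /IH].
  by exists [::], s, u; rewrite racg_word_nil invg1 conjg1.
case=> u1 [s' [u2 [-> te]]]; exists (s :: u1), s', u2; split=> //.
by rewrite racg_word_cons invgM conjgM -te -conjgM racg_genV racg_gen2 conjg1.
Qed.

Lemma side_is_reflection x t : side x t -> reflection t.
Proof.
by move/word_side_split=> [u1 [s [_ [_ ->]]]]; exists (word u1)^-1, s.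
Qed.

(** The exchange condition: the reflection attached to an occurrence of a letter deletes that
    occurrence. *)
Lemma racg_word_exchange u1 s u2 :
  gen s ^ (word u1)^-1 * word (u1 ++ s :: u2) = word (u1 ++ u2).
Proof.
rewrite !racg_word_cat racg_word_cons conjgE invgK.
by rewrite !mulgA mulgVK racg_genK.
Qed.

Fact len_exists (x : G) : exists n, `[< exists2 u, word u = x & size u = n >].
Proof.
by exists (size (racg_repr x)); apply/asboolP; exists (racg_repr x); rewrite // racg_reprK.
Qed.

Definition len (x : G) : nat := ex_minn (len_exists x).

Lemma len_word_le u : len (word u) <= size u.
Proof.
by rewrite /len; case: ex_minnP => n _; apply; apply/asboolP; exists u.
Qed.

Definition reduced (u : seq T) : bool := len (word u) == size u.

Lemma reduced_exists x : exists2 u, word u = x & reduced u.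
Proof.
have : exists2 u, word u = x & size u = len x.
  by rewrite /len; case: ex_minnP => n /asboolP.
by case=> u <- su; exists u; rewrite // /reduced su.
Qed.

Lemma len_gen s : len (gen s) <= 1.
Proof. exact: (len_word_le [:: s]). Qed.

Lemma lenM x y : len (x * y) <= len x + len y.
Proof.
have [u <- /eqP ->] := reduced_exists x; have [v <- /eqP ->] := reduced_exists y.
by rewrite -racg_word_cat -size_cat len_word_le.
Qed.

Lemma len1 : len 1 = 0%N.
Proof. by apply/eqP; rewrite -leqn0; apply: (len_word_le [::]). Qed.

Lemma racg_wordV u : (word u)^-1 = word (rev u).
Proof.
elim: u => [|s u IH]; first by rewrite racg_word_nil invg1.
by rewrite racg_word_cons invgM IH rev_cons racg_word_rcons racg_genV.
Qed.

Lemma len_side x t : side x t -> len (t * x) < len x.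
Proof.
have [u <- /eqP ->] := reduced_exists x.
rewrite side_word => /word_side_split[u1 [s [u2 [-> ->]]]].
rewrite racg_word_exchange (leq_ltn_trans (len_word_le _)) //.
by rewrite !size_cat /= addnS.
Qed.

Lemma len_sideN x t : reflection t -> ~~ side x t -> len x < len (t * x).
Proof.
move=> rt; rewrite -side_reflM // => /len_side.
by rewrite mulgA reflection2 // mul1g.
Qed.

Lemma reduced_cat u v : reduced (u ++ v) -> reduced u /\ reduced v.
Proof.
rewrite /reduced racg_word_cat size_cat => /eqP E.
have := lenM (word u) (word v); rewrite E => le.
have lu := len_word_le u; have lv := len_word_le v.
split; rewrite eqn_leq ?lu ?lv /=.
  by rewrite -(leq_add2r (size v)) (leq_trans le) // leq_add2l.
by rewrite -(leq_add2l (size u)) (leq_trans le) // leq_add2r.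
Qed.

(** Otherwise the reflection would lengthen the element by [len_sideN], whereas it deletes a letter
    of a shortest word. *)
Lemma reduced_side u1 s u2 : reduced (u1 ++ s :: u2) ->
  side (word (u1 ++ s :: u2)) (gen s ^ (word u1)^-1).
Proof.
move/eqP=> red; apply: contraT => /len_sideN lt.
have /lt : reflection (gen s ^ (word u1)^-1) by exists (word u1)^-1, s.
rewrite racg_word_exchange red => /leq_trans/(_ (len_word_le _)).
by rewrite !size_cat /= addnS ltnNge leqnSn.
Qed.

Lemma reduced_cons_side s u : reduced (s :: u) -> side (word (s :: u)) (gen s).
Proof.
by move=> red; have := @reduced_side [::] s u red; rewrite racg_word_nil invg1 conjg1.
Qed.

Lemma reduced_prefix_side u1 u2 t : reduced (u1 ++ u2) ->
  side (word u1) t -> side (word (u1 ++ u2)) t.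
Proof.
move=> red; rewrite side_word => /word_side_split[v1 [s [v2 [E ->]]]].
by move: red; rewrite E -catA /=; apply: reduced_side.
Qed.

Lemma reduced_next_side u1 s u2 : reduced (u1 ++ s :: u2) ->
  ~~ side (word u1) (gen s ^ (word u1)^-1).
Proof.
rewrite -cat1s catA => /reduced_cat[/eqP red _]; apply/negP => /len_side.
have -> : gen s ^ (word u1)^-1 * word u1 = word (u1 ++ [:: s]).
  by rewrite racg_word_cat conjgE invgK !mulgA mulgVK.
by rewrite red size_cat addn1 ltnNge (leq_trans (len_word_le _)) // leqnSn.
Qed.

Definition letters_in (L : {set T}) (u : seq T) : bool := all (mem L) u.

(** Appending a letter to a reduced word either keeps it reduced or, by exchange, amounts to
    deleting a letter. No new letter ever appears, so reduction stays inside a special subgroup. *)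
Lemma reduce_word u :
  exists v, [/\ word v = word u, reduced v & forall L, letters_in L u -> letters_in L v].
Proof.
elim/last_ind: u => [|u s [v [vu red sub]]].
  by exists [::]; split=> //; rewrite /reduced racg_word_nil len1.
have E : gen s ^ (word v)^-1 * word v = word (rcons v s).
  by rewrite racg_word_rcons conjgE invgK !mulgA mulgVK.
have Ew : word (rcons v s) = word (rcons u s) by rewrite !racg_word_rcons vu.
case: (boolP (side (word v) (gen s ^ (word v)^-1))) => [|ns].
  rewrite side_word => /word_side_split[v1 [s' [v2 [Ev tE]]]].
  have Ew2 : word (v1 ++ v2) = word (rcons u s).
    by rewrite -Ew -E tE Ev racg_word_exchange.
  exists (v1 ++ v2); split=> //.
    rewrite /reduced eqn_leq len_word_le /= Ew2 -Ew racg_word_rcons.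
    have := lenM (word v * gen s) (gen s); rewrite racg_genK (eqP red).
    rewrite Ev !size_cat /= addnS => /leq_trans-/(_ _ (leq_add (leqnn _) (len_gen s))).
    by rewrite addn1 ltnS.
  move=> L; rewrite /letters_in all_rcons => /andP[_ /sub].
  by rewrite /letters_in Ev !all_cat /= => /andP[-> /andP[_ ->]].
exists (rcons v s); split=> //.
  rewrite /reduced eqn_leq len_word_le /= -E size_rcons -(eqP red) len_sideN //.
  by exists (word v)^-1, s.
move=> L; rewrite /letters_in !all_rcons => /andP[-> /sub]; exact.
Qed.
End Words.

(** * Closure properties of subgroups and of their conjugates *)

Section Subgroups.
Local Open Scope group_scope.
Variables (G : groupType) (K : set G).
Hypothesis K_subgroup : is_subgroup K.

Lemma subgroup1 : K 1.
Proof. by case: K_subgroup. Qed.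

Lemma subgroupV x : K x -> K x^-1.
Proof. by case: K_subgroup => K1 Kd /(Kd _ _ K1); rewrite mul1g. Qed.

Lemma subgroupM x y : K x -> K y -> K (x * y).
Proof.
by case: K_subgroup => _ Kd Kx /subgroupV Ky; have := Kd _ _ Kx Ky; rewrite invgK.
Qed.

Lemma subgroupJ x y : K x -> K y -> K (x ^ y).
Proof. by move=> Kx Ky; apply: subgroupM; [apply: subgroupV | apply: subgroupM]. Qed.

Lemma conj_setE g x : conj_set g K x <-> K (x ^ g).
Proof.
split=> [[y Ky <-]|Kx]; first by rewrite -{1}(invgK g) -mulgA -conjgE conjgKV.
by exists (x ^ g) => //; rewrite conjgE !mulgA mulgV mul1g mulgK.
Qed.

End Subgroups.

Lemma generated_subgroup (G : groupType) (A : set G) : is_subgroup (generated A).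
Proof.
split=> [K [[K1 _] _] //|x y Ax Ay K KA].
by case: (KA) => [[_ Kd] _]; apply: Kd; [apply: Ax | apply: Ay].
Qed.

Lemma conj_set_subgroup (G : groupType) (K : set G) g :
  is_subgroup K -> is_subgroup (conj_set g K).
Proof.
move=> sK; split; first by apply/conj_setE; rewrite conj1g; apply: subgroup1.
move=> x y /conj_setE Kx /conj_setE Ky; apply/conj_setE.
by rewrite conjMg conjVg; apply: subgroupM => //; apply: subgroupV.
Qed.

(** * Parabolic subgroups and crossing walls *)

Section Walls.
Local Open Scope classical_set_scope.
Local Open Scope group_scope.
Variables (T : finType) (e : rel T).

Notation G := (racg e).
Notation word := (racg_word e).
Notation gen := (racg_gen e).

Lemma specialP (L : {set T}) (x : G) :
  special_subgroup e L x <-> exists2 u, letters_in L u & word u = x.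
Proof.
split=> [|[u uL <-]]; last first.
  elim: u uL => [_|s u IH /= /andP[sL /IH uL]].
    exact: (subgroup1 (generated_subgroup _)).
  rewrite racg_word_cons; apply: (subgroupM (generated_subgroup _)) => //.
  by move=> K [_ sub]; apply: sub; exists s.
pose W : set G := [set y | exists2 u, letters_in L u & word u = y].
move=> /(_ W); apply; split; first split; first by exists [::].
  move=> y z [u uL <-] [v vL <-]; exists (u ++ rev v).
    by rewrite /letters_in all_cat all_rev; apply/andP.
  by rewrite racg_word_cat racg_wordV.
by move=> y [s sL ->]; exists [:: s]; rewrite //= /letters_in /= sL.
Qed.

Lemma special_subgroupP L : is_subgroup (special_subgroup e L).
Proof. exact: generated_subgroup. Qed.
Hint Resolve special_subgroupP : core.

Lemma special_gen (L : {set T}) s : s \in L -> special_subgroup e L (gen s).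
Proof. by move=> sL K [_ sub]; apply: sub; exists s. Qed.

Lemma special_reduced L x : special_subgroup e L x ->
  exists u, [/\ word u = x, reduced e u & letters_in L u].
Proof.
by move/specialP=> [u uL <-]; have [v [<- red /(_ L uL)]] := reduce_word e u; exists v.
Qed.

Lemma special_side L x t : special_subgroup e L x -> side x t -> special_subgroup e L t.
Proof.
move/specialP=> [u uL <-]; rewrite side_word => /word_side_split[u1 [s [u2 [E ->]]]].
move: uL; rewrite E /letters_in all_cat /= => /and3P[u1L sL _].
apply: (subgroupJ (special_subgroupP L)) => //; first exact: special_gen.
by apply: (subgroupV (special_subgroupP L)) => //; apply/specialP; exists u1.
Qed.

(** The relations preserve the parity of the number of occurrences of each letter. This homomorphism
    to Z/2 is constant on conjugacy classes and recognizes the type of a reflection. *)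
Definition parity s (x : G) : bool := odd (count_mem s (racg_repr x)).

Lemma parity_word s u : parity s (word u) = odd (count_mem s u).
Proof.
have E v b : word_act (fun t b => (t == s) (+) b) v b = odd (count_mem s v) (+) b.
  by elim: v => //= t v ->; rewrite oddD oddb addbA.
rewrite /parity -[LHS]addbF -[RHS]addbF -!E.
by apply: word_act_eq (racg_reprK _) => [t b|t t' b _]; rewrite ?addKb // addbCA.
Qed.

Lemma parityM s x y : parity s (x * y) = parity s x (+) parity s y.
Proof.
elim/racg_word_ind: x => u; elim/racg_word_ind: y => v.
by rewrite -racg_word_cat !parity_word count_cat oddD.
Qed.

Lemma parityJ s x y : parity s (x ^ y) = parity s x.
Proof.
rewrite conjgE !parityM addbCA -parityM mulVg (parity_word s [::]) /=.
by rewrite addbF.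
Qed.

Lemma parity_gen s t : parity s (gen t) = (t == s).
Proof. by rewrite parity_word /= addn0 oddb. Qed.

Lemma special_gen_mem (L : {set T}) s : special_subgroup e L (gen s) -> s \in L.
Proof.
move/specialP=> [u /allP uL E]; apply: contraT => sL.
have := parity_gen s s; rewrite -E parity_word eqxx => /idP.
by rewrite (count_memPn _) //; apply: contra sL => /uL.
Qed.

(** With [t] the first wall of the subgroup to be crossed, [x * gen q = t * x] shows that [t] is the
    only wall of the subgroup separating [1] from [t]. The first letter of a reduced word for [t] in
    [L] is such a wall. *)
Lemma first_crossing (L : {set T}) x q :
  (forall t, special_subgroup e L t -> ~~ side x t) ->
  special_subgroup e L (gen q ^ x^-1) ->
  exists2 s, s \in L & gen q ^ x^-1 = gen s.
Proof.
set t := gen q ^ x^-1 => far Pt.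
have rt : reflection t by exists x^-1, q.
have st y : special_subgroup e L y -> side t y = (y == t).
  move=> Py; have: side (x * gen q) y = side (t * x) y.
    by congr side; rewrite /t conjgE invgK !mulgA mulgVK.
  rewrite side_mul_gen sideM (negbTE (far _ Py)) /=.
  have /far/negbTE -> : special_subgroup e L (y ^ t) by apply: (subgroupJ (special_subgroupP L)).
  by rewrite addbF => <-; rewrite -(conjgKV x (gen q)) -/t (inj_eq (conjg_inj x)).
have [[|s u] [E red]] := special_reduced Pt.
  by have := side_reflection rt; rewrite -E racg_word_nil side1.
move=> /= /andP[sL _]; exists s => //.
apply/eqP; rewrite eq_sym -st; last exact: special_gen.
by rewrite -E reduced_cons_side.
Qed.

(** Take [p] closest to [x]. No wall of a letter of [L] separates [1] from [p^-1 * x], since moving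
    [p] across it would shorten the distance; by [first_crossing], the first wall of the subgroup to
    be crossed would be of this kind. *)
Lemma gate_exists L x : exists2 p, special_subgroup e L p &
  forall t, special_subgroup e L t -> ~~ side (p^-1 * x) t.
Proof.
have ex : exists n, `[< exists2 p, special_subgroup e L p & len (p^-1 * x) = n >].
  exists (len (1^-1 * x)); apply/asboolP; exists 1 => //.
  exact: (subgroup1 (special_subgroupP L)).
case: (ex_minnP ex) => n /asboolP[p Pp len_p] min; exists p => //.
set y := p^-1 * x in len_p *.
have far s : s \in L -> ~~ side y (gen s).
  move=> sL; apply/negP => /len_side; rewrite len_p ltnNge.
  rewrite min //; apply/asboolP; exists (p * gen s).
    by apply: (subgroupM (special_subgroupP L)) => //; apply: special_gen.
  by rewrite invgM racg_genV mulgA.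
have [u uy red] := reduced_exists y.
suff F : forall u1 u2, u = u1 ++ u2 ->
    forall t, special_subgroup e L t -> ~~ side (word u1) t.
  by move=> t; rewrite -uy; apply: (F u [::]); rewrite cats0.
elim/last_ind => [|u1 q IH] u2 Eu t Pt; first by rewrite racg_word_nil side1.
rewrite cat_rcons in Eu; have {}IH := IH _ Eu.
rewrite racg_word_rcons side_mul_gen (negbTE (IH _ Pt)) /=.
apply/eqP => tq; have tE : t = gen q ^ (word u1)^-1 by rewrite -tq conjgK.
have [s sL Es] := first_crossing IH (eq_rect _ _ Pt _ tE).
by have := far _ sL; rewrite -Es -uy Eu reduced_side // -Eu.
Qed.

(* Ping-pong: [s] and [r] act on the line by the reflections in [0] and [2]. *)
Lemma alternating_neq s r : ~~ e s r -> ~~ e r s -> forall u v,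
  all (mem [:: s; r]) u -> all (mem [:: s; r]) v ->
  path (fun a b => a != b) r u -> path (fun a b => a != b) s v ->
  s != r -> u != [::] -> word u <> word v.
Proof.
move=> nsr nrs u v usr vsr pu pv sr un uv.
pose f (a : T) (x : Z) : Z := if a == s then (- x)%Z else if a == r then (4 - x)%Z else x.
have f2 a : involutive (f a) by move=> x; rewrite /f; case: (a == s); case: (a == r); lia.
have fC a b x : e a b -> f a (f b x) = f b (f a x).
  move=> eab; rewrite /f; case: (eqVneq a s) => [as_|_]; case: (eqVneq b s) => [bs|_] //.
  - by case: (eqVneq b r) => // br; move: eab; rewrite as_ br (negbTE nsr).
  - by case: (eqVneq a r) => // ar; move: eab; rewrite bs ar (negbTE nrs).
  - by case: (a == r); case: (b == r).
have E := word_act_eq f2 fC 1%Z uv.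
have H w : all (mem [:: s; r]) w ->
    (path (fun a b => a != b) r w ->
      (word_act f w 1%Z < 2)%Z /\ (w != [::] -> (word_act f w 1%Z < 0)%Z)) /\
    (path (fun a b => a != b) s w -> (0 < word_act f w 1%Z)%Z).
  elim: w => [|a w IH] /=; first by split=> // _; split.
  rewrite !inE => /andP[/orP[]/eqP-> /IH[IHr IHs]]; split=> /andP[].
  - by move=> _ /IHs; rewrite /f eqxx; lia.
  - by rewrite eqxx.
  - by rewrite eqxx.
  - by move=> _ /IHr[]; rewrite /f eqxx (eq_sym r s) (negbTE sr); lia.
have [/(_ pu)[_ /(_ un)]] := H u usr; have [_ /(_ pv)] := H v vsr; lia.
Qed.

Hypotheses (e_sym : symmetric e) (e_irr : irreflexive e).

Lemma reduced_alternating u : reduced e u -> sorted (fun a b => a != b) u.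
Proof.
elim: u => //= s [|t u] //= IH red.
have [_ red'] := reduced_cat (u := [:: s]) red.
rewrite IH // andbT; apply: contraTneq red => <-.
have /eqP : word [:: s, s & u] = word u by rewrite !racg_word_cons racg_genK.
rewrite /reduced => /eqP ->.
by rewrite neq_ltn (leq_ltn_trans (len_word_le _ _)).
Qed.

(* After projecting [w] to the parabolic [<s, r>], an infinite dihedral group
   if [s] and [r] are not adjacent, a reduced word cannot start with both. *)
Lemma two_descents w s r : s != r -> side w (gen s) -> side w (gen r) -> e s r.
Proof.
move=> sr ws wr; apply: contraT => nsr.
have nrs : ~~ e r s by rewrite e_sym.
pose L : {set T} := [set a in [:: s; r]].
have [p Pp far] := gate_exists L w.
have [u [up red uL]] := special_reduced Pp.
have sL : s \in L by rewrite !inE eqxx.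
have rL : r \in L by rewrite !inE eqxx orbT.
have S a : a \in L -> side p (gen a) = side w (gen a).
  move=> aL; rewrite -[in RHS](mulVKg p w) sideM (negbTE (far _ _)) ?addbF //.
  by apply: (subgroupJ (special_subgroupP L)) => //; apply: special_gen.
have {ws}ps : side p (gen s) by rewrite S.
have {wr}pr : side p (gen r) by rewrite S.
have uL' : all (mem [:: s; r]) u.
  by move: uL; rewrite /letters_in; apply: sub_all => a; rewrite /= !inE.
have alt := reduced_alternating red.
have {far S Pp} : exists a b, [/\ a != b, ~~ e a b, ~~ e b a, side p (gen b) & 
    all (mem [:: a; b]) u /\ path (fun a b => a != b) b u].
  case: u up red alt uL uL' => [up|c u up red alt uL uL'].
    by move: ps; rewrite -up racg_word_nil side1.
  move: (uL'); rewrite /= !inE => /andP[/orP[] /eqP cE _]; rewrite cE in uL' alt *.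
    by exists s, r; split=> //; split=> //=; rewrite eq_sym sr.
  exists r, s; rewrite eq_sym; split=> //; split=> /=; last by rewrite sr.
  by move: uL'; rewrite (@eq_all _ _ (mem [:: r; s])) => [|a]; rewrite /= ?inE ?eqxx /= ?inE 1?orbC.
case=> a [b [ab nab nba]]; rewrite -up side_word => /word_side_split[u1 [c [u2 [E bE]]]].
rewrite E cat_path all_cat /= => -[/and3P[u1ab cab _] /and3P[pu1 lc _]].
have [] := @alternating_neq a b nab nba (rcons u1 c) (b :: u1) => //.
- by rewrite all_rcons /= cab.
- by rewrite /= !inE eqxx orbT.
- by rewrite rcons_path pu1.
- by rewrite /= ab.
- by case: (u1).
- by rewrite racg_word_rcons racg_word_cons bE conjgE invgK !mulgA mulgVK.
Qed.

(** If [r] is the first letter, [gen s * word (r :: u) = word (r :: u) * gen s'] has both [s] and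
    [r] as possible first letters, so these are adjacent by [two_descents]. Then [r] is removed. *)
Lemma carrier u s s' : reduced e u -> gen s ^ word u = gen s' ->
  ~~ side (word u) (gen s) -> all (e s) u.
Proof.
elim: u => //= r u IH red Eu nu.
have rs : r != s.
  by apply: contraNneq nu => <-; apply: reduced_cons_side.
have wr := reduced_cons_side red.
have gC : gen s * word (r :: u) = word (r :: u) * gen s' by rewrite -Eu conjgE mulVKg.
have gen_inj : gen r != gen s.
  by apply: contraNneq nu => <-.
have esr : e s r.
  apply: (@two_descents (gen s * word (r :: u))); first by rewrite eq_sym.
    by rewrite sideM side_gen eqxx conjg_self (negbTE nu).
  rewrite gC side_mul_gen wr /= -Eu (inj_eq (conjg_inj _)).
  exact: gen_inj.
have [_ redu] := reduced_cat (u := [:: r]) red.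
have sr_conj : gen s ^ gen r = gen s.
  by rewrite conjgE (racg_gen_commute esr) mulKg.
rewrite esr /=; apply: IH => //.
  by rewrite -Eu racg_word_cons conjgM sr_conj.
apply: contra nu; rewrite racg_word_cons sideM side_gen sr_conj => ->.
by rewrite eq_sym (negbTE gen_inj).
Qed.

Lemma commute_conjP (G' : groupType) (x y z : G') : commute (x ^ z) (y ^ z) <-> commute x y.
Proof.
by rewrite /commute -!conjMg; split=> [/conjg_inj|->].
Qed.

Lemma commute_word s u : all (e s) u -> commute (gen s) (word u).
Proof.
elim: u => [_|r u IH /= /andP[sr /IH su]]; first exact: commute1.
by rewrite racg_word_cons; apply: commuteM => //; apply: racg_gen_commute.
Qed.

(** On a geodesic from [x] to [z], which crosses the wall of [a] but not that of [b], [p] is the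
    last vertex before the wall of [a]. *)
Lemma crossing_point (a b x z : G) : side x a != side z a -> side x b = side z b ->
  exists p s, [/\ a ^ p = gen s, side p a = side x a & side p b = side x b].
Proof.
have [u uE red] := reduced_exists (x^-1 * z).
have sep t : side (word u) (t ^ x) = (side x t != side z t).
  by rewrite uE side_mulV conjgK; case: side; case: side.
move=> xza xzb; move: (sep a); rewrite xza => sa.
move: (sa); rewrite side_word => /word_side_split[u1 [s [u2 [Eu aE]]]].
have aE' : a ^ (x * word u1) = gen s by rewrite conjgM aE conjgKV.
exists (x * word u1), s; split=> //; rewrite sideM.
  by rewrite aE (negbTE (@reduced_next_side _ _ _ s u2 _)) ?addbF -?Eu.
have /negbTE-> : ~~ side (word u1) (b ^ x); last by rewrite addbF.
move: (sep b); rewrite xzb eqxx => /negbT; apply: contra; rewrite Eu.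
by apply: reduced_prefix_side; rewrite -Eu.
Qed.

(* The reduced word between two points of the carrier of the wall of [a]
   on the same side consists of letters commuting with the type of [a]. *)
Lemma crossing_commute (a b x y z w : G) :
  side x a != side z a -> side y a != side w a -> side x a = side y a ->
  side x b = side z b -> side y b = side w b -> side x b != side y b ->
  commute a b.
Proof.
move=> xza ywa xya xzb ywb xyb.
have [p [s [ap pa pb]]] := crossing_point xza xzb.
have [q [s' [aq qa qb]]] := crossing_point ywa ywb.
have [u uE red] := reduced_exists (p^-1 * q).
have su : all (e s) u.
  apply: (carrier (s' := s') red); rewrite uE -ap.
    by rewrite -conjgM mulVKg.
  by rewrite side_mulV conjgK pa qa xya addbb.
have : side (word u) (b ^ p).
  by rewrite uE side_mulV conjgK pb qb; move: xyb; case: side; case: side.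
rewrite side_word => /word_side_split[u1 [r [u2 [Eu bE]]]].
apply/(commute_conjP a b p); rewrite ap bE.
move: su; rewrite Eu all_cat /= => /and3P[su1 sr _].
have C := commute_word su1.
have {1}-> : gen s = gen s ^ (word u1)^-1.
  by rewrite conjgE invgK mulgA -C mulgK.
by apply/commute_conjP/racg_gen_commute.
Qed.

(** Otherwise, up to conjugation, [gen s] commutes with a different conjugate of itself. By
    [carrier] all letters of a reduced word for a conjugate of [gen s] are adjacent to [s], so [s]
    does not occur in it, against its odd parity. *)
Lemma same_type_commute s x y : commute (gen s ^ x) (gen s ^ y) -> gen s ^ x = gen s ^ y.
Proof.
move=> C; apply/eqP; apply: contraT => ne.
pose z := y * x^-1; pose b := gen s ^ z.
have {}C : commute (gen s) b.
  by apply/(commute_conjP _ _ x); rewrite -conjgM mulgVK.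
have {}ne : b != gen s.
  by rewrite -(inj_eq (conjg_inj x)) -conjgM mulgVK eq_sym.
have bs : b ^ gen s = b by rewrite conjgE -C mulKg.
have [u uE red] := reduced_exists (gen s ^ z^-1).
have su : all (e s) u.
  apply: (carrier (s' := s) red); rewrite uE.
    by rewrite -{1}(conjgK z (gen s)) -/b -conjJg bs conjgK.
  rewrite conjgE invgK (sideM z) -/b (sideM (gen s)) side_gen bs sideV conjgK.
  by rewrite (negbTE ne) addbb.
have : parity s (word u) by rewrite uE parityJ parity_gen eqxx.
rewrite parity_word (count_memPn _) //; apply/negP => /(allP su).
by rewrite /= e_irr.
Qed.

End Walls.

(** * Intervals and medians *)

Section Intervals.
Local Open Scope group_scope.
Variables (T : finType) (e : rel T).
Hypotheses (e_sym : symmetric e) (e_irr : irreflexive e).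

Notation G := (racg e).
Notation word := (racg_word e).
Notation gen := (racg_gen e).

Definition between (x z v : G) : Prop :=
  forall t, side x t = side z t -> side v t = side x t.

Lemma between_sym x z v : between x z v -> between z x v.
Proof. by move=> xzv t zx; rewrite xzv. Qed.

Lemma between_refl x v : between x x v -> v = x.
Proof.
move=> xxv; apply: (mulgI x^-1); rewrite mulVg.
have [[|s u] uE red] := reduced_exists (x^-1 * v); first by rewrite -uE.
by have := reduced_cons_side red; rewrite uE side_mulV xxv // addbb.
Qed.

Lemma between_sub x z v x' z' : between x z v -> between x v x' -> between v z z' ->
  [/\ between x' z' v, between x z x' & between x z z'].
Proof.
move=> xzv xvx' vzz'; split=> t; move: (xzv t) (xvx' t) (vzz' t);
  by do 5 case: (side _ t); intuition.
Qed.

Lemma between_word x u1 u2 : reduced e (u1 ++ u2) ->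
  between x (x * word (u1 ++ u2)) (x * word u1).
Proof.
move=> red t; rewrite !sideM => /esym; rewrite -[RHS]addbF => /addbI N.
by rewrite -[RHS]addbF; congr addb; apply: contraFF N; apply: reduced_prefix_side.
Qed.

(** Induction on the position of the letter of [u] crossing [t]. If the wall [t'] crossed just
    before also separates [1] from [y], use [t']. If not, [1], [v], [word u] and [y] occupy the four
    quadrants of [t] and [t']; these commute, and swapping their letters moves [t] forward. *)
Lemma common_first_letter u y t : reduced e u ->
  side (word u) t -> side y t -> exists s, side (word u) (gen s) /\ side y (gen s).
Proof.
move=> red; rewrite side_word => /word_side_split[u1 [s [u2 [Eu tE]]]].
move=> yt; have [k] := ubnP (size u1).
elim: k => // k IH in u t red u1 s u2 Eu tE yt *.
case/lastP: u1 Eu tE => [|u1 r] Eu tE szu1.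
  exists s; rewrite -(conjg1 (gen s)) -invg1 -(racg_word_nil e) -tE; split=> //.
  by rewrite Eu tE; apply: reduced_side; rewrite -Eu.
rewrite cat_rcons in Eu; rewrite size_rcons ltnS in szu1.
pose t' := gen r ^ (word u1)^-1.
case: (boolP (side y t')) => [yt'|nyt'].
  by apply: IH Eu _ yt' szu1.
have ut : side (word u) t.
  by rewrite Eu tE -cat_rcons; apply: reduced_side; rewrite cat_rcons -Eu.
have ut' : side (word u) t' by rewrite Eu; apply: reduced_side; rewrite -Eu.
pose v := word (rcons u1 r).
have vt : ~~ side v t.
  by rewrite tE; apply: (@reduced_next_side _ _ _ s u2); rewrite cat_rcons -Eu.
have vt' : side v t'.
  have redv : reduced e (rcons u1 r).
    by move: red; rewrite Eu -cat_rcons => /reduced_cat[].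
  by have := @reduced_side _ _ u1 r [::]; rewrite cats1; apply.
have C : commute t t'.
  apply: (@crossing_commute _ _ e_sym t t' v 1 (word u) y);
   by rewrite ?side1 ?ut ?ut' ?yt ?vt' ?(negbTE vt) ?(negbTE nyt').
have tr : t' ^ word u1 = gen r by rewrite /t' conjgKV.
have ts : t ^ word u1 = gen s.
  have -> : t = t ^ t' by rewrite conjgE C mulKg.
  rewrite -conjgM tE -conjgM racg_word_rcons.
  have -> : (word u1 * gen r)^-1 * (t' * word u1) = 1; last by rewrite conjg1.
  by rewrite (conjgC t') tr mulVg.
have Crs : commute (gen r) (gen s).
  by rewrite -tr -ts; apply/commute_conjP/commute_sym.
have Ew : word u = word (u1 ++ s :: r :: u2).
  by rewrite Eu !racg_word_cat !racg_word_cons !mulgA -(mulgA _ (gen r)) Crs !mulgA.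
have [] := IH (u1 ++ s :: r :: u2) t _ u1 s (r :: u2) erefl _ yt szu1.
- by move: red; rewrite /reduced -Ew Eu !size_cat.
- by rewrite -ts conjgK.
by move=> q [uq yq]; exists q; rewrite Ew.
Qed.

(** Among the points [p] with the second property, [v] being one, take the closest to [x]. A wall
    separating [p] from both [x] and [y] would give a common first letter of [p^-1 * x] and
    [p^-1 * y], and stepping along it would bring [p] closer to [x]. *)
Lemma median_exists v x y : exists p, between x y p /\
  forall t, side v t != side p t -> side v t != side x t /\ side v t != side y t.
Proof.
pose ok p := forall t, side v t != side p t -> side v t != side x t /\ side v t != side y t.
have ex : exists n, `[< exists2 p, ok p & len (p^-1 * x) = n >].
  by exists (len (v^-1 * x)); apply/asboolP; exists v => // t; rewrite eqxx.
case: (ex_minnP ex) => n /asboolP[p okp len_p] min; exists p; split=> // t xyt.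
apply/eqP; apply: contraT => pxt.
have [u uE red] := reduced_exists (p^-1 * x).
have neq_addb (b c : bool) : b (+) c = (b != c) by case: b; case: c.
have [|| s [us ys]] := @common_first_letter u (p^-1 * y) (t ^ p) red.
- by rewrite uE side_mulV conjgK neq_addb.
- by rewrite side_mulV conjgK neq_addb -xyt.
rewrite uE side_mulV neq_addb in us; rewrite side_mulV neq_addb in ys.
have ok' : ok (p * gen s).
  move=> r; rewrite side_mul_gen.
  case: (eqVneq (r ^ p) (gen s)) => [rs|_]; last by rewrite addbF; apply: okp.
  move: us ys (okp r); rewrite -rs conjgK.
  by case: (side v r); case: (side p r); case: (side x r); case: (side y r) => //= _ _ /(_ erefl)[].
have := min (len ((p * gen s)^-1 * x)).
rewrite -len_p invgM racg_genV -mulgA leqNgt len_side; last first.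
  by rewrite side_mulV neq_addb.
by apply; apply/asboolP; exists (p * gen s); rewrite // invgM racg_genV mulgA.
Qed.

Fixpoint word_walls (u : seq T) : seq G :=
  if u is s :: u' then gen s :: [seq t ^ gen s | t <- word_walls u'] else [::].

Lemma size_word_walls u : size (word_walls u) = size u.
Proof. by elim: u => //= s u <-; rewrite size_map. Qed.

Lemma mem_map_conj (s : T) (w : seq G) t : (t \in [seq x ^ gen s | x <- w]) = (t ^ gen s \in w).
Proof.
by rewrite -{1}(conjgK (gen s) t) racg_genV (mem_map (conjg_inj (gen s))).
Qed.

Lemma reduced_walls u : reduced e u ->
  uniq (word_walls u) /\ forall t, (t \in word_walls u) = side (word u) t.
Proof.
elim: u => [_|s u IH red]; first by split=> // t; rewrite [RHS]side1.
have [_ /IH[un mem]] := reduced_cat (u := [:: s]) red.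
have E t : side (word (s :: u)) t = (t == gen s) (+) side (word u) (t ^ gen s).
  by rewrite racg_word_cons sideM side_gen.
move: (reduced_cons_side red); rewrite E eqxx /= => ns; split.
  by rewrite /= mem_map_conj mem ns map_inj_uniq //; apply: conjg_inj.
move=> t; rewrite inE mem_map_conj mem [RHS]E.
by case: eqP => //= ->; rewrite ns.
Qed.

(** A reduced word crosses each of its walls once, so lengths can be bounded by counting walls. *)
Lemma walls_exist (x : G) : exists w, [/\ uniq w, size w = len x & forall t, (t \in w) = side x t].
Proof.
have [u <- red] := reduced_exists x; have [un mem] := reduced_walls red.
by exists (word_walls u); rewrite size_word_walls (eqP red).
Qed.

End Intervals.

(** * Cosets crossed by two non-commuting walls *)

Section Overlap.
Local Open Scope group_scope.
Variables (T : finType) (e : rel T).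
Hypotheses (e_sym : symmetric e) (e_irr : irreflexive e).

Notation G := (racg e).
Notation word := (racg_word e).
Notation gen := (racg_gen e).
Notation P := (special_subgroup e).

Lemma commute_words u v :
  (forall s t, s \in u -> t \in v -> s = t \/ e s t) -> commute (word u) (word v).
Proof.
have H s w : (forall t, t \in w -> s = t \/ e s t) -> commute (word w) (gen s).
  elim: w => [_|t w IH H]; first exact/commute_sym/commute1.
  rewrite racg_word_cons; apply/commute_sym/commuteM.
    case: (H t) => [|->|/racg_gen_commute //]; first by rewrite inE eqxx.
    exact: commute_refl.
  by apply/commute_sym/IH => t' t'w; apply: H; rewrite inE t'w orbT.
elim: u => [_|s u IH Huv]; first exact/commute_sym/commute1.
rewrite racg_word_cons; apply/commute_sym/commuteM.
  by apply: H => t; apply: Huv; rewrite inE eqxx.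
by apply/commute_sym/IH => s' t' s'u; apply: Huv; rewrite inE s'u orbT.
Qed.

(** Two successive gates, on the left and then on the right, produce the shortest representative [d]
    of the double coset of [k]. *)
Lemma double_coset_gate (L M : {set T}) (k : G) : exists p d p',
  [/\ P L p, P M p', p * d = k * p',
      forall t, P L t -> ~~ side d t & forall t, P M t -> ~~ side d^-1 t].
Proof.
have [p Pp far] := gate_exists L k.
have [p' Pp' far'] := gate_exists M (p^-1 * k)^-1.
exists p, (p^-1 * k * p'), p'; split=> //.
- by rewrite !mulgA mulgV mul1g.
(* The second projection does not spoil the first: a wall [t] gained by [d] would have [t ^ d] in
   the subgroup of [M], a wall that [d^-1] does not cross. *)
- move=> t Pt; apply/negP => dt.
  have := far t Pt; rewrite -[p^-1 * k](mulgK p') sideM dt /= negbK => S.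
  have PM := special_side (subgroupV (special_subgroupP e M) Pp') S.
  by have := far' _ PM; rewrite -invgM sideV conjgK dt.
- by move=> t Pt; rewrite invgM far'.
Qed.

(** The first letter [s] of [x] is a wall of [x * d = d * x ^ d], where [d = word w], and [d] does
    not cross it, so [gen s ^ d] lies in the subgroup of [M]. It is a single letter by
    [first_crossing], and [carrier] makes every letter of [w] adjacent to [s]. *)
Lemma double_coset_letters (L M : {set T}) (w : seq T) : reduced e w ->
  (forall t, P L t -> ~~ side (word w) t) ->
  (forall t, P M t -> ~~ side (word w)^-1 t) ->
  forall x, P L x -> P M (x ^ word w) ->
  exists2 u, word u = x & forall s, s \in u -> [/\ s \in L, s \in M & all (e s) w].
Proof.
move=> redw farL farM x PLx; have [u [uE red uL]] := special_reduced PLx.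
rewrite -uE => PM; exists u => //; elim: u uL red PM {x PLx uE} => //= s u IH /andP[sL uL] red PM.
have [_ redu] := reduced_cat (u := [:: s]) red.
have PLs := special_gen (e := e) sL.
have PLu : P L (word u) by apply/specialP; exists u.
have us := reduced_cons_side red.
have PLsu : P L (word (s :: u)).
  by rewrite racg_word_cons; apply: (subgroupM (special_subgroupP e L)).
have PMs : P M (gen s ^ word w).
  apply: (special_side PM).
  have: side (word (s :: u) * word w) (gen s).
    rewrite sideM us (negbTE (farL _ _)) //.
    exact: (subgroupJ (special_subgroupP e L)).
  by rewrite conjgC sideM (negbTE (farL _ PLs)).
have [s' _ Es'] : exists2 s', s' \in M & gen s ^ (word w)^-1^-1 = gen s'.
  by apply: first_crossing farM _; rewrite invgK.
rewrite invgK in Es'.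
have sw := carrier e_sym redw Es' (farL _ PLs).
have sM : s \in M.
  have E : gen s ^ word w = gen s by rewrite conjgE (commute_word sw) mulKg.
  by apply: (special_gen_mem (e := e)); rewrite -E.
move=> t; rewrite inE => /orP[/eqP->|/IH]; first by [].
apply => //; move: PM; rewrite racg_word_cons conjMg.
move/(subgroupM (special_subgroupP e M) (subgroupV (special_subgroupP e M) PMs)).
by rewrite mulKg.
Qed.

Variables (I : eqType) (L : I -> {set T}).

Hypothesis square_complete : forall i s u v, s \notin L i ->
  u \in L i -> v \in L i -> u != v -> ~~ e u v -> e s u -> e s v -> False.
Hypothesis clique_overlap : forall i j, i != j -> clique e (L i :&: L j).

(** After passing to a shortest double coset representative, [a] and [b] are words in letters of
    [L i] and [L j] adjacent to all of [w]. As [a] and [b] do not commute, two of these letters are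
    distinct and non-adjacent. The clique condition then forces [i = j], and the square condition
    puts the letters of [w] in [L i]. *)
Lemma noncommuting_overlap i j h k a b :
  P (L i) (a ^ h) -> P (L i) (b ^ h) -> P (L j) (a ^ k) -> P (L j) (b ^ k) ->
  ~ commute a b -> i = j /\ P (L i) (h^-1 * k).
Proof.
move=> ia ib ja jb nab.
have [p [d [p' [Pp Pp' E farL farM]]]] := double_coset_gate (L i) (L j) (h^-1 * k).
have [w wE red] := reduced_exists d.
rewrite -wE in farL farM.
have toL x : P (L i) (x ^ h) -> P (L i) (x ^ (h * p)).
  by rewrite conjgM => ?; apply: (subgroupJ (special_subgroupP e _)).
have toM x : P (L j) (x ^ k) -> P (L j) ((x ^ (h * p)) ^ word w).
  have -> : (x ^ (h * p)) ^ word w = (x ^ k) ^ p'.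
    by rewrite wE -!conjgM -mulgA E !mulgA mulgV mul1g.
  move=> ?;  exact: (subgroupJ (special_subgroupP e _)).
have [u uE Hu] := double_coset_letters red farL farM (toL _ ia) (toM _ ja).
have [v vE Hv] := double_coset_letters red farL farM (toL _ ib) (toM _ jb).
have [s [t [su tv st nest]]] : exists s t, [/\ s \in u, t \in v, s != t & ~~ e s t].
  apply: contrapT => H; apply: nab; apply/(commute_conjP _ _ (h * p)).
  rewrite -uE -vE; apply: commute_words => s t su tv.
  case: (eqVneq s t) => [->|st]; first by left.
  by right; apply: contraT => nest; case: H; exists s, t.
have [sL sM sw] := Hu _ su; have [tL tM tw] := Hv _ tv.
have ij : i = j.
  apply/eqP; apply: contraT => /clique_overlap/(_ s t).
  by rewrite !inE sL sM tL tM (negbTE nest) => /(_ erefl erefl st).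
split=> //; rewrite -ij in Pp'.
rewrite -(mulgK p' (_ * k)) -E -wE.
apply: (subgroupM (special_subgroupP e _)); last first.
  exact: (subgroupV (special_subgroupP e _)).
apply: (subgroupM (special_subgroupP e _)) => //; apply/specialP; exists w => //.
apply/allP => r rw /=; apply: contraT => rL.
case: (@square_complete i r s t) => //; rewrite e_sym.
  exact: (allP sw).
exact: (allP tw).
Qed.

(** As [t] fixes [a] and [b], the coset of [h] and its image under [t] share two non-commuting
    elements; hence they coincide. *)
Lemma noncommuting_normalizer i h a b t : reflection t ->
  P (L i) (a ^ h) -> P (L i) (b ^ h) -> ~ commute a b ->
  commute t a -> commute t b -> P (L i) (t ^ h).
Proof.
move=> rt ia ib nab ta tb.
have cj x : commute t x -> x ^ (t * h) = x ^ h.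
  by move=> C; rewrite conjgM [x ^ t]conjgE -C mulKg.
have := @noncommuting_overlap i i h (t * h) a b ia ib.
by rewrite !cj // => /(_ ia ib nab)[_]; rewrite mulgA -mulgA -conjgE.
Qed.

End Overlap.

(** * Sufficiency of the conditions *)

Section Embedding.
Local Open Scope classical_set_scope.
Local Open Scope group_scope.
Variables (T : finType) (e : rel T).
Hypotheses (e_sym : symmetric e) (e_irr : irreflexive e).

Notation G := (racg e).
Notation word := (racg_word e).
Notation gen := (racg_gen e).

(** Otherwise the first wall between the gate of [x] and [x] would be a wall of the subgroup. *)
Lemma walls_in_special (L : {set T}) x :
  (forall t, side x t -> special_subgroup e L t) -> special_subgroup e L x.
Proof.
move=> xL; have sP := special_subgroupP e L.
have [p Pp far] := gate_exists L x.
suff -> : x = p by [].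
have [[|s u] uE red] := reduced_exists (p^-1 * x).
  by rewrite -[LHS](mulVKg p) -uE racg_word_nil mulg1.
have us := reduced_cons_side red.
have Ps : special_subgroup e L (gen s ^ p^-1).
  move: us; rewrite uE side_mulV.
  case pE : (side p _) => /=; first by move=> _; apply: special_side pE.
  exact: xL.
have /far : special_subgroup e L (gen s).
  by rewrite -(conjgKV p (gen s)); apply: (subgroupJ sP).
by rewrite -uE us.
Qed.

Lemma between_special (L : {set T}) (x z v : G) : special_subgroup e L (x^-1 * z) ->
  between x z v -> special_subgroup e L (x^-1 * v).
Proof.
move=> Pz xzv; apply: walls_in_special => t; rewrite side_mulV => xv.
apply: (special_side Pz); rewrite side_mulV; move: xv (xzv (t ^ x^-1)).
by do 3 case: side => //=; move=> _ /(_ erefl).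
Qed.

Lemma between_len (x z v : G) : between x z v -> len (x^-1 * v) <= len (x^-1 * z).
Proof.
move=> xzv; have [w [uw <- wE]] := walls_exist (x^-1 * v).
have [w' [_ <- wE']] := walls_exist (x^-1 * z).
apply: uniq_leq_size => // t; rewrite wE wE' !side_mulV.
by move: (xzv (t ^ x^-1)); do 3 case: side => //=; move=> /(_ erefl).
Qed.

Definition covered (m : nat) (A : G -> Prop) : Prop :=
  exists2 w : seq G, size w <= m & forall t, A t -> t \in w.

Lemma covered_or m n (A B C : G -> Prop) : covered m A -> covered n B ->
  (forall t, C t -> A t \/ B t) -> covered (m + n) C.
Proof.
move=> [u um Au] [v vn Bv] CAB; exists (u ++ v); first by rewrite size_cat leq_add.
by move=> t /CAB[/Au|/Bv]; rewrite mem_cat => ->; rewrite ?orbT.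
Qed.

Lemma covered_walls (x z : G) : covered (len (x^-1 * z)) (fun t => side x t != side z t).
Proof.
have [w [_ szw wE]] := walls_exist (x^-1 * z).
exists [seq t ^ x^-1 | t <- w]; first by rewrite size_map szw.
move=> t xzt; rewrite -(conjgK x t) (mem_map (conjg_inj _)) wE side_mulV conjgK.
by move: xzt; case: side; case: side.
Qed.

(** By [same_type_commute] there is at most one wall for each vertex of the graph. *)
Lemma covered_commuting (A : G -> Prop) : (forall t, A t -> reflection t) ->
  (forall s t, A s -> A t -> commute s t) -> covered #|T| A.
Proof.
move=> Ar AC.
(* The value [1] stands for the types of which [A] contains no wall. *)
have choice s : exists t, forall x, A (gen s ^ x) -> gen s ^ x = t.
  case: (pselect (exists x, A (gen s ^ x))) => [[x Ax]|nA]; last first.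
    by exists 1 => x Ax; case: nA; exists x.
  exists (gen s ^ x) => y Ay; exact: (same_type_commute e_sym e_irr (AC _ _ Ay Ax)).
have [f fP] := boolp.choice choice.
exists [seq f s | s <- enum T]; first by rewrite size_map cardE.
move=> t At; have [x [s tE]] := Ar _ At; rewrite tE in At *.
by rewrite (fP _ _ At) map_f // mem_enum.
Qed.

Lemma finite_len N : finite_set [set x : G | len x <= N].
Proof.
pose f (u : {m : 'I_N.+1 & m.-tuple T}) : G := word (tagged u).
apply: (@sub_finite_set _ _ (f @` setT)); last exact/finite_image/finite_finset.
move=> x /=; have [u <- /eqP ->] := reduced_exists x => uN.
by exists (Tagged (fun m : 'I_N.+1 => m.-tuple T)
  (in_tuple u : (Ordinal (uN : size u < N.+1)).-tuple T)).
Qed.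

(** * The relative Cayley graph and its hyperbolicity *)

Variables (I : finType) (L : I -> {set T}) (g : I -> G).

Hypothesis square_complete : forall i s u v, s \notin L i ->
  u \in L i -> v \in L i -> u != v -> ~~ e u v -> e s u -> e s v -> False.
Hypothesis clique_overlap : forall i j, i != j -> clique e (L i :&: L j).

Notation P i := (special_subgroup e (L i)).
Notation H := (fun i => parabolic (g i) (L i)).

(* The walls crossing the coset [h P i] are the reflections [t] such that
   [t ^ h] is in [P i]. *)
Definition near (x y : G) : Prop := forall i h s t, P i (s ^ h) -> P i (t ^ h) ->
  side x s != side y s -> side x t != side y t -> commute s t.

Lemma near_sym x y : near x y -> near y x.
Proof. by move=> xy i h s t Ps Pt; rewrite ![side y _ == _]eq_sym; apply: xy Ps Pt. Qed.

Lemma nearM z x y : near x y -> near (z * x) (z * y).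
Proof.
move=> xy i h s t Ps Pt; rewrite !sideM !(inj_eq (@addbI _)) => xs xt.
apply/(commute_conjP _ _ z); apply: (xy i (z^-1 * h)) => //; rewrite -conjgM mulVKg //.
Qed.

Lemma nearP x y : near x y <-> near 1 (x^-1 * y).
Proof.
split=> [/(@nearM x^-1)|/(@nearM x)]; first by rewrite mulVg.
by rewrite mulg1 mulVKg.
Qed.

Lemma near_gen x s : near x (x * gen s).
Proof.
move=> i h a b _ _; rewrite !side_mul_gen.
have E c : (side x c != side x c (+) (c ^ x == gen s)) = (c ^ x == gen s).
  by case: side; case: (_ == gen s).
rewrite !E => /eqP as_ /eqP bs; apply/(commute_conjP _ _ x).
by rewrite as_ bs; apply: commute_refl.
Qed.

Lemma between_near x z v : near x z -> between x z v -> near x v.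
Proof.
move=> xz xzv i h s t Ps Pt xs xt; apply: (xz i h) => //.
  by move: xs (xzv s); do 3 case: (side _ s) => //=; move=> _ /(_ erefl).
by move: xt (xzv t); do 3 case: (side _ t) => //=; move=> _ /(_ erefl).
Qed.

Definition small_letters : set G := [set x | near 1 x].
Notation adj := (cayley_adj small_letters H).

Lemma parabolicE i x : H i x <-> P i (x ^ g i).
Proof. exact: conj_setE. Qed.

Lemma parabolic_subgroup i : is_subgroup (H i).
Proof. exact/conj_set_subgroup/special_subgroupP. Qed.

Lemma cayley_edgeP l x y : cayley_edge small_letters H l x y <->
  if l is Some i then H i (x^-1 * y) else near x y.
Proof.
split=> [[a]|].
  case: l => [i|] Ha [->|->]; rewrite ?mulKg ?invgM ?mulgVK //.
  - exact: (subgroupV (parabolic_subgroup i)).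
  - by apply/nearP; rewrite mulKg.
  - by apply/near_sym/nearP; rewrite mulKg.
case: l => [i|] xy; exists (x^-1 * y); rewrite ?mulVKg //; last by left.
  by left.
exact: (nearP x y).1 xy.
Qed.

Lemma adjP x y : adj x y <-> near x y \/ exists i, H i (x^-1 * y).
Proof.
split=> [[[i|] /cayley_edgeP]|[xy|[i xy]]].
- by right; exists i.
- by left.
- by exists None; apply/cayley_edgeP.
- by exists (Some i); apply/cayley_edgeP.
Qed.

Lemma adj_sym x y : adj x y -> adj y x.
Proof. by case=> l [a la [->|->]]; exists l, a => //; [right|left]. Qed.

Lemma dle_mul x y : dle adj (len y) x (x * y).
Proof.
have [u <- /eqP ->] := reduced_exists y; elim: u x => [|s u IH] x.
  by rewrite racg_word_nil mulg1; apply: dle_refl.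
rewrite racg_word_cons mulgA -[size _]add1n; apply: (dle_trans _ (IH _)).
by apply: dle1; apply/adjP; left; apply: near_gen.
Qed.

(** A letter of [H i] moves [x] parallel to the coset [x * g i * P i]; [shift] bounds the detour
    from [x] to this coset. *)
Definition shift : nat := \max_i len (g i).

Lemma len_shift i : len (g i) <= shift.
Proof. exact: (leq_bigmax (F := fun i => len (g i))). Qed.

Lemma dle_shift i x : dle adj shift x (x * g i).
Proof. exact: dle_le (len_shift i) (dle_mul _ _). Qed.

Lemma dle_coset i x y : P i (x^-1 * y) -> dle adj (2 * shift + 1) x y.
Proof.
move=> xy; have A z : dle adj shift (z * (g i)^-1) z.
  by have := dle_shift i (z * (g i)^-1); rewrite mulgVK.
have -> : 2 * shift + 1 = (shift + (1 + shift))%N by lia.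
apply: (dle_trans (dle_sym adj_sym (A x)) (dle_trans _ (A y))).
apply: dle1; apply/adjP; right; exists i; apply/parabolicE.
by rewrite conjgE invgM invgK !mulgA mulgVK mulVg mul1g.
Qed.

Lemma sep_reflection (x y t : G) : side x t != side y t -> reflection t.
Proof.
by case xt : (side x t); case yt : (side y t) => // _; [move: xt | move: yt];
  apply: side_is_reflection.
Qed.

Lemma coset_gate i h v : exists2 y, P i (h^-1 * y) &
  forall t, P i (t ^ h) -> side v t = side y t.
Proof.
have sP := special_subgroupP e (L i).
have [p Pp far] := gate_exists (L i) (h^-1 * v); exists (h * p); first by rewrite mulKg.
move=> t Pt.
have /far : P i (t ^ (h * p)) by rewrite conjgM; apply: (subgroupJ sP).
by rewrite mulgA -invgM side_mulV conjgK; case: side; case: side.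
Qed.

Definition separating_coset (x y : G) (i : I) (h : G) : Prop := exists a b,
  [/\ P i (a ^ h), P i (b ^ h), ~ commute a b, side x a != side y a & side x b != side y b].

Lemma not_near x y : ~ near x y -> exists i h, separating_coset x y i h.
Proof.
move=> nxy; apply: contrapT => H; apply: nxy => i h a b Pa Pb xa xb.
by apply: contrapT => nab; apply: H; exists i, h, a, b.
Qed.

Lemma separating_coset_sym x y i h : separating_coset x y i h -> separating_coset y x i h.
Proof.
by case=> a [b [Pa Pb nab xa xb]]; exists a, b; rewrite ![side y _ == _]eq_sym.
Qed.

(* A wall separating [v] from its gate but not from [x] would be crossed by
   every wall of the coset that separates [v] from [x]. *)
Lemma gate_near i h v x y : separating_coset v x i h ->
  (forall j k, separating_coset v x j k -> j = i /\ P i (h^-1 * k)) ->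
  P i (h^-1 * y) -> (forall t, P i (t ^ h) -> side v t = side y t) -> near v y.
Proof.
have sP := special_subgroupP e (L i).
move=> [a [b [Pa Pb nab va vb]]] uniq_sep Py gate j k c d Pc Pd vc vd.
have outside t : side v t != side y t -> ~ P i (t ^ h).
  by move=> vt /gate E; rewrite E eqxx in vt.
have cross t w : side v w != side y w -> side v w = side x w -> P i (t ^ h) ->
    side v t != side x t -> commute w t.
  move=> vw xw Pt vt; have rt := sep_reflection vt.
  have Pty : P i (y^-1 * (t * y)).
    rewrite -conjgE -(mulVKg h y) conjgM; exact: (subgroupJ sP).
  (* Both [y] and [t * y] lie in the coset of [h], so a wall separating them would cross this coset,
     contrary to [outside]. *)
  have yty : side y w = side (t * y) w.
    apply/eqP; apply: contraT => yw; case: (outside w vw).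
    have W : side (y^-1 * (t * y)) (w ^ y).
      by rewrite side_mulV conjgK; move: yw; case: side; case: side.
    have Pwy := special_side Pty W.
    have -> : h = y * (h^-1 * y)^-1 by rewrite invgM invgK mulVKg.
    by rewrite conjgM; apply: (subgroupJ sP) => //; apply: (subgroupV sP).
  apply/commute_sym.
  apply: (@crossing_commute _ _ e_sym t w v y x (t * y)) => //.
    by rewrite side_reflM //; case: side.
  exact: gate.
(* If not, [t] commutes with both [a] and [b], and [noncommuting_normalizer] makes it a wall of the
   coset. *)
have sep t : side v t != side y t -> side v t != side x t.
  move=> vt; apply: contraT; rewrite negbK => /eqP xt; case: (outside t vt).
  apply: (noncommuting_normalizer e_sym square_complete clique_overlap
    (sep_reflection vt) Pa Pb nab); exact: cross.
(* By [sep], the walls [c] and [d] also separate [v] from [x], so uniqueness identifies their coset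
   with that of [h], which no wall between [v] and [y] crosses. *)
apply: contrapT => ncd.
have [ji Pk] : j = i /\ P i (h^-1 * k).
  by apply: uniq_sep; exists c, d; split=> //; apply: sep.
case: (outside c vc); rewrite ji in Pc.
have -> : h = k * (h^-1 * k)^-1 by rewrite invgM invgK mulVKg.
by rewrite conjgM; apply: (subgroupJ sP) => //; apply: (subgroupV sP).
Qed.

Definition coset_diameter : nat := 2 * shift + 3.

(** The path goes from [v] to its gate [y], through the coset to the gate [z] of [x], and on to
    [x]. *)
Lemma unique_separating_dle i h v x : separating_coset v x i h ->
  (forall j k, separating_coset v x j k -> j = i /\ P i (h^-1 * k)) ->
  dle adj coset_diameter v x.
Proof.
move=> sep uniq_sep; have sP := special_subgroupP e (L i).
have [y Py yE] := coset_gate i h v; have [z Pz zE] := coset_gate i h x.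
have vy : near v y by exact: (gate_near sep uniq_sep Py yE).
have xz : near x z.
  apply: (gate_near (separating_coset_sym sep) _ Pz zE) => j k.
  by move/separating_coset_sym/uniq_sep.
have yz : dle adj (2 * shift + 1) y z.
  apply: (@dle_coset i); have := subgroupM sP (subgroupV sP Py) Pz.
  by rewrite invgM invgK -mulgA mulVKg.
have -> : coset_diameter = (1 + (2 * shift + 1 + 1))%N by rewrite /coset_diameter; lia.
apply: dle_trans (dle_trans yz _); first by apply/dle1/adjP; left.
by apply/dle1/adjP; left; apply: near_sym.
Qed.

(* Every wall between [v] and its median with [x, y] crosses every wall
   between [v] and its median with [y, z]; hence a coset separating [v] from
   the former is unique if some coset separates it from the latter. *)
Lemma between_thin x y z v : between x z v ->
  exists w, (between x y w \/ between y z w) /\ dle adj coset_diameter v w.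
Proof.
move=> xzv.
have [p [xyp pE]] := median_exists e_sym v x y.
have [q [yzq qE]] := median_exists e_sym v y z.
have near_dle w : near v w -> dle adj coset_diameter v w.
  move=> vw; apply: (@dle_le _ _ 1); first by rewrite /coset_diameter; lia.
  by apply/dle1/adjP; left.
case: (pselect (near v q)) => [/near_dle vq|/not_near[j [k [c [d [Pc Pd ncd vc vd]]]]]].
  by exists q; split=> //; right.
exists p; split; first by left.
case: (pselect (near v p)) => [/near_dle //|/not_near[i [h sep]]].
(* The points [v], [z], [x] and [y] occupy the four quadrants of [s] and [t]. *)
have cross s t : side v s != side p s -> side v t != side q t -> commute s t.
  move=> /pE[vx vy] /qE[vy' vz].
  have S r : side v r != side x r -> side v r = side z r.
    by move: (xzv r); do 3 case: (side _ r) => //=; move=> /(_ erefl).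
  have S' r : side v r != side z r -> side v r = side x r.
    by move: (xzv r); do 3 case: (side _ r) => //=; move=> /(_ erefl).
  have sz := S s vx; have tx := S' t vz.
  apply: (@crossing_commute _ _ e_sym s t v z x y) => //.
    by rewrite -sz.
  by move: vy' vz; case: (side v t); case: (side y t); case: (side z t).
(* Commuting with the two non-commuting walls of such a coset, [c] and [d] cross it as well; two
   cosets both crossed by [c] and [d] coincide. *)
have contains j' k' : separating_coset v p j' k' -> P j' (c ^ k') /\ P j' (d ^ k').
  case=> a [b [Pa Pb nab va vb]].
  have norm := noncommuting_normalizer e_sym square_complete clique_overlap.
  split; [apply: (norm _ _ _ _ _ (sep_reflection vc) Pa Pb nab)
        | apply: (norm _ _ _ _ _ (sep_reflection vd) Pa Pb nab)];
    exact/commute_sym/cross.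
apply: (unique_separating_dle sep) => j' k' /contains[Pc' Pd'].
have [Pci Pdi] := contains _ _ sep.
have [-> Pk] := noncommuting_overlap e_sym square_complete clique_overlap Pci Pdi Pc' Pd' ncd.
by split.
Qed.

Definition thin_bound : nat := 7 * shift + 7.

(** For a letter of [H i], apply [between_thin] twice to the quadrilateral [x], [x * g i],
    [z * g i], [z]: two sides have length at most [shift], and the interval of the third stays in a
    coset of [P i]. The longest route adds up to [thin_bound]. *)
Lemma between_edge x z v : adj x z -> between x z v ->
  dle adj thin_bound v x \/ dle adj thin_bound v z.
Proof.
have dS := dle_sym adj_sym.
have near_end i y w : between y (y * g i) w -> dle adj shift w y.
  move=> /between_len; rewrite mulKg => len_w; apply: dS.
  apply: dle_le (leq_trans len_w (len_shift i)) _.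
  by have := dle_mul y (y^-1 * w); rewrite mulVKg.
move=> /adjP[xz xzv|[i /parabolicE Pxz] xzv].
  left; apply: (@dle_le _ _ 1); first by rewrite /thin_bound; lia.
  by apply/dS/dle1/adjP; left; apply: between_near xzv.
have [w [[xw|wz] vw]] := between_thin (x * g i) xzv.
  left; apply: dle_le (dle_trans vw (near_end _ _ _ xw)).
  by rewrite /thin_bound /coset_diameter; lia.
have [w' [[yw'|w'z] ww']] := between_thin (z * g i) wz; last first.
  right; apply: dle_le (dle_trans vw (dle_trans ww' (near_end _ _ _ (between_sym w'z)))).
  by rewrite /thin_bound /coset_diameter; lia.
left; have yw : dle adj (2 * shift + 1) w' (x * g i).
  apply/dS/(@dle_coset i); apply: between_special yw'.
  by move: Pxz; rewrite conjgE invgM !mulgA.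
apply: dle_le (dle_trans vw (dle_trans ww' (dle_trans yw (dS _ _ _ (dle_shift i x))))).
by rewrite /thin_bound /coset_diameter; lia.
Qed.

Lemma between_walk x z : exists n p, [/\ p 0%N = x, p n = z,
  forall i, i < n -> adj (p i) (p i.+1) & forall i, i <= n -> between x z (p i)].
Proof.
have [u uE red] := reduced_exists (x^-1 * z).
exists (size u), (fun i => x * word (take i u)); split.
- by rewrite take0 racg_word_nil mulg1.
- by rewrite take_size uE mulVKg.
- move=> i iu; have s0 : T by case: (u) iu.
  rewrite (take_nth s0 iu) racg_word_rcons mulgA.
  by apply/adjP; left; apply: near_gen.
- move=> i iu; have zE : z = x * word (take i u ++ drop i u) by rewrite cat_take_drop uE mulVKg.
  by rewrite {1}zE; apply: between_word; rewrite cat_take_drop.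
Qed.

Lemma adj_hyperbolic : gromov_hyperbolic adj.
Proof.
apply: (@thin_intervals_hyperbolic _ _ adj_sym (@between T e) between_walk _ _ _ thin_bound).
- exact: between_sub.
- exact: between_sym.
- by [].
- exact: between_refl.
- exact: between_edge.
- move=> x y z v /(between_thin y)[w [Iw vw]]; exists w; split=> //.
  by apply: dle_le vw; rewrite /thin_bound /coset_diameter; lia.
Qed.

Lemma small_letters_generated : generated (small_letters `|` \bigcup_i H i) = setT.
Proof.
apply/seteqP; split=> // x _.
have sP := generated_subgroup (small_letters `|` \bigcup_i H i).
elim/racg_word_ind: x => u; elim: u => [|s u IH]; first exact: (subgroup1 sP).
rewrite racg_word_cons; apply: (subgroupM sP) => // K [_]; apply; left.
by rewrite /small_letters /=; have := @near_gen 1 s; rewrite mul1g.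
Qed.

(** * Local finiteness of the relative metrics *)

(** The walls counted commute pairwise for a letter of X. For a letter of [H j], the detours through
    [g j] cost [2 * shift] walls; two non-commuting walls among the others would identify the
    cosets, making the edge one of Cay(H_i, H_i). *)
Lemma hat_edge_covered i x y : hat_adj small_letters H i x y ->
  covered (#|T| + 2 * shift) (fun t => P i (t ^ g i) /\ side x t != side y t).
Proof.
have weaken m (A : G -> Prop) : m <= #|T| + 2 * shift -> covered m A ->
    covered (#|T| + 2 * shift) A.
  by move=> ml [w wm Aw]; exists w => //; apply: leq_trans ml.
case=> -[j|] /cayley_edgeP xy nxy; last first.
  apply: (@weaken #|T|); first by lia.
  apply: covered_commuting => [t [_ /sep_reflection] //|s t [Ps xs] [Pt xt]].
  exact: xy Ps Pt xs xt.
pose x' := x * g j; pose y' := y * g j.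
have Pxy : P j (x'^-1 * y').
  by move/parabolicE: xy; rewrite /x' /y' conjgE invgM !mulgA.
have mid : covered #|T| (fun t => P i (t ^ g i) /\ side x' t != side y' t).
  apply: covered_commuting => [t [_ /sep_reflection] //|s t [Ps xs] [Pt xt]].
  have inj_ r : side x' r != side y' r -> P j (r ^ x').
    move=> xr; apply: (special_side Pxy); rewrite side_mulV conjgK.
    by move: xr; case: side; case: side.
  apply: contrapT => nst; case: nxy.
  have [ij Px] := noncommuting_overlap e_sym square_complete clique_overlap
    Ps Pt (inj_ _ xs) (inj_ _ xt) nst.
  rewrite -ij in xy.
  have Hx : H i x by apply/parabolicE; move: Px; rewrite /x' -ij.
  split=> //; first by rewrite ij.
  by have := subgroupM (parabolic_subgroup i) Hx xy; rewrite mulVKg.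
have xx' : covered shift (fun t => side x t != side x' t).
  have [w wl wE] := covered_walls x x'; exists w => //.
  by apply: leq_trans wl _; rewrite mulKg len_shift.
have yy' : covered shift (fun t => side y t != side y' t).
  have [w wl wE] := covered_walls y y'; exists w => //.
  by apply: leq_trans wl _; rewrite mulKg len_shift.
have -> : #|T| + 2 * shift = (#|T| + (shift + shift))%N by lia.
apply: (covered_or mid (covered_or xx' yy' (fun t => id))) => t [Pt xt].
case: (eqVneq (side x t) (side x' t)) => xx; last by right; left.
case: (eqVneq (side y t) (side y' t)) => yy; last by right; right.
by left; split=> //; rewrite -xx -yy.
Qed.

Lemma hat_walk_covered i m x y : walk (hat_adj small_letters H i) m x y ->
  covered (m * (#|T| + 2 * shift)) (fun t => P i (t ^ g i) /\ side x t != side y t).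
Proof.
elim: m x => [|m IH] x; first by move=> /= ->; exists [::] => // t []; rewrite eqxx.
case=> z /hat_edge_covered xz /IH zy; rewrite mulSn.
apply: covered_or xz zy _ => t [Pt xt].
case: (eqVneq (side x t) (side z t)) => [E|xz]; last by left.
by right; rewrite -E.
Qed.

(** The length of [h^-1 * k] is the number of walls between [h] and [k]: those crossing the coset of
    [g i], bounded along the walk, and at most [shift] more at each end. *)
Lemma hat_ball_finite i h m : H i h ->
  finite_set [set k | H i k /\ dist_le (hat_adj small_letters H i) h k m].
Proof.
move=> Hh; pose N := m * (#|T| + 2 * shift) + (shift + shift).
apply: (@sub_finite_set _ _ ((fun x => h * x) @` [set x : G | len x <= N])); last first.
  exact/finite_image/finite_len.
move=> k [Hk /dist_leP[m' m'm /hat_walk_covered cov]].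
exists (h^-1 * k); last by rewrite mulVKg.
have ends x : covered shift (fun t => side x t != side (x * g i) t).
  have [w wl wE] := covered_walls x (x * g i); exists w => //.
  by apply: leq_trans wl _; rewrite mulKg len_shift.
have sP := special_subgroupP e (L i).
have Phk : P i ((h * g i)^-1 * (k * g i)).
  have /parabolicE := subgroupM (parabolic_subgroup i) (subgroupV (parabolic_subgroup i) Hh) Hk.
  by rewrite conjgE invgM !mulgA.
have [w wl wE] : covered (m' * (#|T| + 2 * shift) + (shift + shift))
    (fun t => side h t != side k t).
  apply: (covered_or cov (covered_or (ends h) (ends k) (fun t => id))) => t hk.
  case: (eqVneq (side h t) (side (h * g i) t)) => hh; last by right; left.
  case: (eqVneq (side k t) (side (k * g i) t)) => kk; last by right; right.
  left; split=> //; have Pt : P i (t ^ (h * g i)).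
    apply: (special_side Phk); rewrite side_mulV conjgK -hh -kk.
    by move: hk; case: side; case: side.
  rewrite -(conjgK (h ^ g i) (t ^ g i)) -conjJg -(conjgM t).
  by apply: (subgroupJ sP) => //; apply: (subgroupV sP); move/parabolicE: Hh.
have [w' [uw' szw w'E]] := walls_exist (h^-1 * k).
have wN : size [seq t ^ h | t <- w] <= N.
  by rewrite size_map; apply: leq_trans wl _; rewrite /N leq_add2r leq_mul2r m'm orbT.
rewrite /= -szw; apply: leq_trans (uniq_leq_size uw' _) wN => t; rewrite w'E side_mulV => ht.
rewrite -(conjgKV h t) (mem_map (conjg_inj h)); apply: wE.
by move: ht; case: side; case: side.
Qed.

Lemma parabolics_hyperbolically_embedded : hyperbolically_embedded H.
Proof.
exists small_letters; split.
- exact: small_letters_generated.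
- exact: adj_hyperbolic.
- by move=> i h m; apply: hat_ball_finite.
Qed.

End Embedding.

(** * Necessity of the conditions *)

Section Malnormality.
Local Open Scope classical_set_scope.
Local Open Scope group_scope.
Variables (G : groupType) (I : Type) (X : set G) (H : I -> set G).
Hypothesis H_subgroup : forall i, is_subgroup (H i).

Lemma cayley_edgeM z l x y : cayley_edge X H l x y -> cayley_edge X H l (z * x) (z * y).
Proof. by case=> a la [->|->]; exists a => //; rewrite mulgA; [left|right]. Qed.

Lemma hat_adj_sym i x y : hat_adj X H i x y -> hat_adj X H i y x.
Proof.
case=> l [a la xy] nxy; exists l; last by case=> lE Hy Hx; apply: nxy.
by exists a => //; case: xy; [right|left].
Qed.

Lemma hat_adjM i z x y : H i z -> hat_adj X H i x y -> hat_adj X H i (z * x) (z * y).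
Proof.
move=> Hz [l xy nxy]; exists l; first exact: cayley_edgeM.
have HzV := subgroupV (H_subgroup i) Hz.
case=> lE Hzx Hzy; apply: nxy; split=> //.
  by have := subgroupM (H_subgroup i) HzV Hzx; rewrite mulKg.
by have := subgroupM (H_subgroup i) HzV Hzy; rewrite mulKg.
Qed.

Lemma hat_walkM i z n x y : H i z ->
  walk (hat_adj X H i) n x y -> walk (hat_adj X H i) n (z * x) (z * y).
Proof.
move=> Hz; elim: n x => [|n IH] x /=; first by move=> ->.
by case=> w xw /IH wy; exists (z * w) => //; apply: hat_adjM.
Qed.

(* Cut the walk at its last vertex in [H i]. *)
Lemma last_exit i n x y : walk (cayley_adj X H) n x y ->
  walk (hat_adj X H i) n x y \/ exists h m, H i h /\ walk (hat_adj X H i) m h y.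
Proof.
elim: n x => [|n IH] x /=; first by left.
case=> z [l xz] /IH[zy|]; last by right.
case: (pselect (H i z)) => Hz; first by right; exists z, n.
by left; exists z => //; exists l => // -[].
Qed.

Lemma cayley_connected : generated (X `|` \bigcup_i H i) = setT ->
  forall x, exists n, walk (cayley_adj X H) n 1 x.
Proof.
move=> gen x; have : generated (X `|` \bigcup_i H i) x by rewrite gen.
have adjM z y y' : cayley_adj X H y y' -> cayley_adj X H (z * y) (z * y').
  by case=> l /(cayley_edgeM z); exists l.
have adj_sym y y' : cayley_adj X H y y' -> cayley_adj X H y' y.
  by case=> l [a la [->|->]]; exists l, a => //; [right|left].
have walkM z n y y' : walk (cayley_adj X H) n y y' -> walk (cayley_adj X H) n (z * y) (z * y').
  elim: n y => [|n IH] y /=; first by move=> ->.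
  by case=> w /(adjM z) yw /IH wy; exists (z * w).
pose C : set G := [set x | exists n, walk (cayley_adj X H) n 1 x].
move=> /(_ C); apply; split; first split; first by exists 0%N.
  move=> y z [m Wy] [n Wz]; exists (m + n)%N; apply: walk_cat Wy _.
  have := walkM (y * z^-1) _ _ _ (walk_sym adj_sym Wz).
  by rewrite mulgVK mulg1.
move=> y Xy; exists 1%N; exists y => //.
case: Xy => [Xy|[i _ Hy]]; [exists None | exists (Some i)];
  by exists y => //; left; rewrite mul1g.
Qed.

(** For [k] in the intersection, go from [h0] to [g], by one letter of [H j] to [k * g], and back
    along the translated walk to [k * h0]. The middle edge is forbidden only if [i = j] and [g] is
    in [H i]; otherwise all [k * h0] lie in one finite ball. *)
Lemma embedded_almost_malnormal :
  generated (X `|` \bigcup_i H i) = setT ->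
  (forall i h n, H i h -> finite_set [set k | H i k /\ dist_le (hat_adj X H i) h k n]) ->
  almost_malnormal H.
Proof.
move=> gen fin i j g; apply: contra_notP => nij.
have H1 := subgroup1 (H_subgroup i).
have {gen} [h0 [m [Hh0 W]]] : exists h m, H i h /\ walk (hat_adj X H i) m h g.
  have [n /(@last_exit i)[|//]] := cayley_connected gen g.
  by exists 1, n.
pose f k := k * h0.
have sub : H i `&` conj_set g (H j) `<=`
    f @^-1` [set k | H i k /\ dist_le (hat_adj X H i) h0 k (m + 1 + m)].
  move=> k [Hk [a Ha kE]]; rewrite /f; split; first exact: (subgroupM (H_subgroup i)).
  apply/dist_leP; exists (m + 1 + m)%N => //.
  have kg : k * g = g * a by rewrite -kE mulgVK.
  apply: (walk_cat (walk_cat W _) (walk_sym (@hat_adj_sym i) (hat_walkM Hk W))).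
  exists (k * g) => //; exists (Some j); first by exists a => //; left.
  by case=> -[ji] Hg _; apply: nij; rewrite ji.
apply: sub_finite_set sub _; apply: finite_preimage; last exact: fin.
by move=> x y _ _; apply: mulIg.
Qed.

End Malnormality.

(** * Conditions (1) and (2) from almost malnormality *)

Section Necessity.
Local Open Scope classical_set_scope.
Local Open Scope group_scope.
Variables (T : finType) (e : rel T).
Hypotheses (e_sym : symmetric e) (e_irr : irreflexive e).

Notation G := (racg e).
Notation word := (racg_word e).
Notation gen := (racg_gen e).

Lemma nonadjacent_infinite_order s r k : s != r -> ~~ e s r ->
  (gen s * gen r) ^+ k.+1 <> 1.
Proof.
move=> sr nsr; pose u := flatten (nseq k.+1 [:: s; r]).
have -> : (gen s * gen r) ^+ k.+1 = word u.
  rewrite /u; elim: k.+1 => [|m IH]; first by [].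
  by rewrite expgS IH /= !racg_word_cons mulgA.
rewrite -(racg_word_nil e); apply: (alternating_neq nsr) => //; first by rewrite e_sym.
  by rewrite /u; elim: k.+1 => //= m ->; rewrite !inE !eqxx orbT.
by rewrite /u; elim: k.+1 => //= m ->; rewrite sr eq_sym sr.
Qed.

Lemma nonadjacent_infinite (L : {set T}) (A : set G) h s r :
  s != r -> ~~ e s r -> s \in L -> r \in L ->
  (forall k, A (((gen s * gen r) ^+ k) ^ h)) -> infinite_set A.
Proof.
move=> sr nsr sL rL Ak finA; apply: infinite_nat.
pose f k := ((gen s * gen r) ^+ k) ^ h.
apply: (sub_finite_set (B := f @^-1` A)); first by move=> k _; apply: Ak.
apply: finite_preimage => // m n _ _ /conjg_inj.
have key a b : a < b -> (gen s * gen r) ^+ a <> (gen s * gen r) ^+ b.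
  move=> ab; rewrite -(subnKC ab) addSn -addnS expgnDr -[LHS]mulg1.
  by move/mulgI/esym; apply: nonadjacent_infinite_order.
by case: (ltngtP m n) => // mn E; [case: (key m n) | case: (key n m)].
Qed.

Variables (I : Type) (L : I -> {set T}) (g : I -> G).
Notation H := (fun i => parabolic (g i) (L i)).
Hypothesis malnormal : almost_malnormal H.

Lemma power_parabolic i s r k : s \in L i -> r \in L i ->
  H i (((gen s * gen r) ^+ k) ^ (g i)^-1).
Proof.
move=> sL rL; apply/conj_setE; rewrite conjgKV.
have sP := special_subgroupP e (L i).
elim: k => [|k IH]; first by rewrite expg0; apply: (subgroup1 sP).
rewrite expgS; apply: (subgroupM sP) => //.
by apply: (subgroupM sP); apply: special_gen.
Qed.

(** Conjugated by [g i], [gen s] centralizes the infinitely many powers of [gen u * gen v], so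
    almost malnormality puts it in [H i]. *)
Lemma malnormal_square_complete i s u v : s \notin L i -> u \in L i -> v \in L i ->
  u != v -> ~~ e u v -> commute (gen s) (gen u) -> commute (gen s) (gen v) -> False.
Proof.
move=> sL uL vL uv nuv su sv.
have [|_] := malnormal (i := i) (j := i) (g := gen s ^ (g i)^-1).
  apply: (@nonadjacent_infinite (L i) _ (g i)^-1 u v) => // k.
  split; first exact: power_parabolic.
  apply/conj_setE; rewrite -conjJg.
  have -> : (gen u * gen v) ^+ k ^ gen s = (gen u * gen v) ^+ k.
    by apply/conjg_fixP/commgP/commute_sym/commuteX/commuteM.
  exact: power_parabolic.
move/conj_setE; rewrite conjgKV => /special_gen_mem.
by rewrite (negbTE sL).
Qed.

(** The element [g i * (g j)^-1] conjugates the copy of an infinite dihedral group in [H j] onto its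
    copy in [H i]. *)
Lemma malnormal_clique i j : H i <> H j -> clique e (L i :&: L j).
Proof.
move=> Hij u v /setIP[ui uj] /setIP[vi vj] uv; apply: contraT => nuv.
case: Hij; have [|//] := malnormal (i := i) (j := j) (g := g i * (g j)^-1).
apply: (@nonadjacent_infinite (L i) _ (g i)^-1 u v) => // k.
split; first exact: power_parabolic.
apply/conj_setE; rewrite -conjgM mulKg.
exact: power_parabolic.
Qed.

End Necessity.

Theorem proposition1p9 (T : finType) (e : rel T)
    (e_sym : symmetric e) (e_irr : irreflexive e)
    (n : nat) (L : 'I_n -> {set T}) (g : 'I_n -> racg e)
    (distinct : injective (fun i => parabolic (g i) (L i))) :
  let H := fun i => parabolic (g i) (L i) in
  let conditions :=
    (forall i (s : T), s \notin L i ->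
       ~ (exists u v : T,
            [/\ u \in L i, v \in L i, u != v & ~~ e u v] /\
            commute (racg_gen e s) (racg_gen e u) /\
            commute (racg_gen e s) (racg_gen e v))) /\
    (forall i j, i != j ->
       L i :&: L j = finset.set0 \/ clique e (L i :&: L j)) in
  (hyperbolically_embedded H <-> almost_malnormal H) /\
  (hyperbolically_embedded H <-> conditions).
Proof.
move=> H conditions.
have embedded_malnormal : hyperbolically_embedded H -> almost_malnormal H.
  case=> X [gen _ fin]; apply: embedded_almost_malnormal gen fin => i.
  exact/conj_set_subgroup/special_subgroupP.
have malnormal_conditions : almost_malnormal H -> conditions.
  move=> mal; split=> [i s sL [u [v [[ui vi uv nuv] [su sv]]]]|i j ij].
    exact: (malnormal_square_complete e_sym mal sL ui vi uv nuv su sv).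
  (* An empty intersection is a clique too, so the second alternative always holds. *)
  right; apply: (malnormal_clique e_sym mal) => /distinct E.
  by rewrite E eqxx in ij.
have conditions_embedded : conditions -> hyperbolically_embedded H.
  case=> square overlap; apply: parabolics_hyperbolically_embedded => //.
    move=> i s u v sL ui vi uv nuv su sv; apply: (square i s sL).
    by exists u, v; split=> //; split; apply: racg_gen_commute.
  move=> i j /overlap[->|//] u v; by rewrite inE.
by split; split; auto.
Qed.
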